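(* A Banach space $X$ has the super fixed point property for nonexpansive mappings if and only if $X$ has the super fixed point property for asymptotically nonexpansive mappings in the intermediate sense.
   Context: Let $C$ be a nonempty bounded closed convex subset of a Banach space. A mapping $T:C\to C$ is nonexpansive if $\|Tx-Ty\|\le\|x-y\|$ for all $x,y\in C$. A mapping $T:C\to C$ is asymptotically nonexpansive in the intermediate sense if $T$ is continuous and $\limsup_{n\to\infty}\sup_{x,y\in C}(\|T^nx-T^ny\|-\|x-y\|)\le 0$. A Banach space $Y$ has the fixed point property for nonexpansive mappings (respectively, for asymptotically nonexpansive mappings in the intermediate sense) if for every nonempty bounded closed convex set $C\subset Y$, every nonexpansive (respectively, asymptotically nonexpansive in the intermediate sense) mapping $T:C\to C$ has a fixed point. A Banach space $Y$ is finitely representable in a Banach space $X$ if for each $\varepsilon\in(0,1)$ and every finite-dimensional subspace $M\subset Y$ there exists a linear map $S:M\to X$ with $(1-\varepsilon)\|y\|\le\|Sy\|\le(1+\varepsilon)\|y\|$ for all $y\in M$. A Banach space $X$ has the super fixed point property for nonexpansive mappings (respectively, for asymptotically nonexpansive mappings in the intermediate sense) if every Banach space $Y$ that is finitely representable in $X$ has the fixed point property for nonexpansive mappings (respectively, for asymptotically nonexpansive mappings in the intermediate sense). *)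

(* Defs.v *)
From HB Require Import structures.
From mathcomp Require Import all_boot all_order all_algebra.
From mathcomp Require Import all_classical all_reals all_analysis.

Set Implicit Arguments.
Unset Strict Implicit.
Unset Printing Implicit Defensive.

Import Order.TTheory GRing.Theory Num.Theory.
Import numFieldNormedType.Exports.

Local Open Scope classical_set_scope.
Local Open Scope ring_scope.

(* Banach spaces are real: [Y : completeNormedModType R] with [R : realType].
   A self-map of a set [C] of [Y] is a total [T : Y -> Y] with [set_fun C C T];
   the properties below only constrain the values of [T] on [C]. *)

Section mappings.
Context {R : realType} {Y : completeNormedModType R}.
Implicit Types (C : set Y) (T : Y -> Y).

Definition nonexpansive_on C T : Prop :=
  forall x y, C x -> C y -> `|T x - T y| <= `|x - y|.

Definition intermediate_asymptotically_nonexpansive_on C T : Prop :=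
  {within C, continuous T} /\
  (limn_esup (fun n : nat =>
     ereal_sup [set (`|iter n T x - iter n T y| - `|x - y|)%:E
               | x in C & y in C]) <= 0)%E.

Definition fixed_point_property_for
    (K : set Y -> (Y -> Y) -> Prop) : Prop :=
  forall C, C !=set0 -> bounded_set C -> closed C -> convex_set C ->
  forall T, set_fun C C T -> K C T ->
  exists2 x, C x & T x = x.

End mappings.

Section finite_representability.
Context {R : realType}.

Definition finite_dim_subspace (Y : lmodType R) (M : set Y) : Prop :=
  submod_closed [pred x in M] /\
  exists n (b : 'I_n -> Y),
    M = range (fun c : 'I_n -> R => \sum_(i < n) c i *: b i).

Definition linear_on (Y X : lmodType R) (M : set Y) (S : Y -> X) : Prop :=
  forall a u v, M u -> M v -> S (a *: u + v) = a *: S u + S v.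

Definition finitely_representable (Y X : completeNormedModType R) : Prop :=
  forall eps : R, 0 < eps < 1 ->
  forall M : set Y, finite_dim_subspace M ->
  exists S : Y -> X, linear_on M S /\
    forall y, M y -> (1 - eps) * `|y| <= `|S y| <= (1 + eps) * `|y|.

Definition super (P : completeNormedModType R -> Prop)
    (X : completeNormedModType R) : Prop :=
  forall Y : completeNormedModType R, finitely_representable Y X -> P Y.

Definition FPP_nonexpansive (Y : completeNormedModType R) : Prop :=
  fixed_point_property_for (@nonexpansive_on R Y).

Definition FPP_intermediate_asymptotically_nonexpansive
    (Y : completeNormedModType R) : Prop :=
  fixed_point_property_for
    (@intermediate_asymptotically_nonexpansive_on R Y).

End finite_representability.

(* Main.v *)
(* Let Y be finitely representable in X, let T be asymptotically nonexpansive in the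
   intermediate sense on C in Y, and let Z be the ultrapower of Y; Z is again finitely
   representable in X.  If f n >= n for all n, the map [x_n] |-> [T^(f n) x_n] is
   nonexpansive on the ultrapower of C, and all these maps commute.  When
   limsup_k |T^k y - y| <= e, those z with limsup_f |z - [T^(f n) y]| <= e form a
   closed convex set of small diameter, invariant under all these maps.  An approximate
   common fixed point in it has coordinates x_n close to y with limsup_k |T^k x_n - x_n|
   as small as desired; iterating gives a Cauchy sequence whose limit x satisfies
   T^k x -> x, so T x = x by continuity.

   Common fixed points come from Bruck's argument: on a separable set the fixed point
   set of finitely many commuting nonexpansive maps is a nonexpansive retract, and for a
   sequence of maps with retractions r_n a fixed point of sum_n 2^-(n+1) r_n is common to
   all.  The family of maps above and the set it acts on are not countable or separable,
   but a uniform approximate common fixed point only needs countably many witnesses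
   (a Loewenheim-Skolem argument), so no weak compactness is required. *)

From HB Require Import structures.
Require Import Defs.
From mathcomp Require Import all_boot all_order all_algebra.
From mathcomp Require Import all_classical all_reals all_analysis.
From mathcomp Require Import lra ring.

Set Implicit Arguments.
Unset Strict Implicit.
Unset Printing Implicit Defensive.

Import Order.TTheory GRing.Theory Num.Theory.
Import numFieldNormedType.Exports.

Local Open Scope classical_set_scope.
Local Open Scope ring_scope.

(** * Bruck's retraction theorem *)

Section normed_sets.
Context {R : realType} {Y : normedModType R}.
Implicit Types (C : set Y) (x y : Y).

Lemma convex_setP C : convex_set C <->
  forall x y (t : R), C x -> C y -> 0 <= t <= 1 -> C (t *: x + (1 - t) *: y).
Proof.
split=> [cC x y t Cx Cy /andP[t0 t1]|cC x y t].
  pose k : {i01 R} := Itv01 t0 t1.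
  by have := cC x y k; rewrite !inE => /(_ Cx Cy).
rewrite !inE => Cx Cy; apply: cC => //.
by apply/andP; split; [exact: ge0|exact: le1].
Qed.

Lemma closed_setP C : closed C <->
  forall x, (forall e : R, 0 < e -> exists2 y, C y & `|x - y| < e) -> C x.
Proof.
split=> [cC x h|h].
  apply: cC => B /nbhs_ballP[e /= e0 eB].
  have [y Cy xy] := h _ e0; exists y; split => //; apply: eB.
  by rewrite -ball_normE.
move=> x clx; apply: h => e e0.
have [y [Cy]] := clx (ball x e) (nbhsx_ballx _ _ e0).
by rewrite -ball_normE /= => xy; exists y.
Qed.

Lemma bounded_setP C : bounded_set C <-> exists M : R, forall x, C x -> `|x| <= M.
Proof.
split=> [[M [_ h]]|[M h]].
  by exists (M + 1) => x Cx; apply: (h (M + 1)) => //; rewrite ltrDl.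
exists M; split; first exact: num_real.
by move=> N MN x Cx; apply: (le_trans (h _ Cx)); apply: ltW.
Qed.

End normed_sets.

Lemma cvg_dist_lt {R : realType} {Y : normedModType R} (u : nat -> Y) (l : Y) :
  u @ \oo --> l ->
  forall e : R, 0 < e -> exists N, forall n, (N <= n)%N -> `|l - u n| < e.
Proof.
move=> /cvgrPdist_lt ul e e0; have [N _ hN] := ul e e0.
by exists N => n Nn; exact: hN.
Qed.

Lemma cauchy_seq_cvg {R : realType} {Y : completeNormedModType R} (u : nat -> Y) :
  (forall e : R, 0 < e -> exists N, forall n, (N <= n)%N -> `|u n - u N| <= e) ->
  exists l : Y, u @ \oo --> l.
Proof.
move=> h; suff /cvg_ex[l ul] : cvg (u @ \oo) by exists l.
apply: cauchy_cvg; apply/cauchy_exP => e e0.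
have [N hN] := h (e / 2) (divr_gt0 e0 (ltr0n _ 2)).
exists (u N); exists N => // n /= Nn; rewrite -ball_normE /= distrC.
by apply: (le_lt_trans (hN _ Nn)); lra.
Qed.

Lemma le0_of_le_eps {R : realType} (a : R) :
  (forall e, 0 < e -> a <= e) -> a <= 0.
Proof. by move=> h; apply/ler_addgt0Pl => e e0; rewrite addr0; exact: h. Qed.

Lemma invS_lt {R : realType} (e : R) : 0 < e -> exists k : nat, k.+1%:R^-1 < e.
Proof.
move=> e0; exists (Num.truncn e^-1).
by rewrite invf_plt ?posrE ?ltr0n// truncnS_gt.
Qed.

Lemma dist_eq {R : realType} {Y : normedModType R} (x y : Y) :
  (forall e : R, 0 < e -> `|x - y| <= e) -> x = y.
Proof.
move=> /le0_of_le_eps; rewrite normr_le0 subr_eq0 => /eqP; exact.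
Qed.

Section retraction.
Context {R : realType} {Z : completeNormedModType R}.
Implicit Types (D K : set Z) (x y p : Z).

(** The approximating sequence may leave [D], so separability passes to subsets at once. *)
Definition separable_set D :=
  exists b : nat -> Z, forall x, D x -> forall e : R, 0 < e ->
    exists n, `|x - b n| < e.

(** Enumerating pairs of a centre and a tolerance attaches to each term [c n] its own accuracy
    [a n], so that one index can make both the distance to [c n] and [a n] small. *)
Lemma separable_dense_seq D : D !=set0 -> separable_set D ->
  exists (c : nat -> Z) (a : nat -> R), (forall n, D (c n)) /\ (forall n, 0 < a n) /\
    forall x, D x -> forall e : R, 0 < e -> exists n, `|x - c n| < e /\ a n < e.
Proof.
move=> [d0 Dd0] [b hb].
have /choice[c hc] : forall tk : nat * nat, exists y, D y /\
    ((exists2 z, D z & `|z - b tk.1| < tk.2.+1%:R^-1) ->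
     `|y - b tk.1| < tk.2.+1%:R^-1).
  move=> tk; have [[z Dz zb]|nz] :=
    pselect (exists2 z, D z & `|z - b tk.1| < tk.2.+1%:R^-1).
    by exists z.
  by exists d0.
pose d n := if unpickle n is Some tk then tk else (0, 0)%N.
exists (c \o d), (fun n => (d n).2.+1%:R^-1); split; first by move=> n; apply: (hc _).1.
split=> [n|x Dx e e0]; first by rewrite invr_gt0 ltr0n.
have [k ke] := invS_lt (divr_gt0 e0 (ltr0n _ 2)).
have [t xt] := hb x Dx k.+1%:R^-1 ltac:(by rewrite invr_gt0 ltr0n).
exists (pickle (t, k)); rewrite /= /d pickleK /=; split; last by apply: (lt_trans ke); lra.
have := (hc (t, k)).2 (ex_intro2 _ _ x Dx xt) => /= cb.
have := ler_distD (b t) x (c (t, k)); rewrite (distrC (b t)) => h.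
by apply: (le_lt_trans h); move: {h} xt cb ke; set r := _^-1 => xt cb ke; lra.
Qed.

Definition common_fixed I (s : I -> Z -> Z) D : set Z :=
  [set x | D x /\ forall i, s i x = x].

(* Bruck: let N be the nonexpansive maps of D fixing F pointwise.  The closure of
   {f x | f in N} is invariant under s, hence meets F, so some f in N moves x close
   to F and later composition with N keeps it there; composing over a dense sequence
   of points x gives maps converging pointwise to a retraction. *)
Lemma nonexpansive_retraction I (s : I -> Z -> Z) D :
  D !=set0 -> closed D -> convex_set D -> separable_set D ->
  (forall i, set_fun D D (s i)) -> (forall i, nonexpansive_on D (s i)) ->
  (forall K, K !=set0 -> closed K -> convex_set K -> K `<=` D ->
     (forall i, set_fun K K (s i)) -> common_fixed s K !=set0) ->
  exists r : Z -> Z, [/\ nonexpansive_on D r,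
    forall x, D x -> common_fixed s D (r x) &
    forall p, common_fixed s D p -> r p = p].
Proof.
move=> D0 /closed_setP cD /convex_setP vD sD sDD sN hK.
pose F := common_fixed s D.
pose N (f : Z -> Z) := [/\ set_fun D D f, nonexpansive_on D f & forall p, F p -> f p = p].
have Nid : N id by split.
have Ncomp f g : N f -> N g -> N (f \o g).
  move=> [fD fN fF] [gD gN gF]; split=> [x Dx|x y Dx Dy|p Fp] /=.
  - exact/fD/gD.
  - exact: le_trans (fN _ _ (gD _ Dx) (gD _ Dy)) (gN _ _ Dx Dy).
  - by rewrite gF// fF.
have Ns i : N (s i) by split=> // p [_]; exact.
have Nconv f g t : 0 <= t <= 1 -> N f -> N g ->
    N (fun x => t *: f x + (1 - t) *: g x).
  move=> t01 [fD fN fF] [gD gN gF]; split=> [x Dx|x y Dx Dy|p Fp].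
  - by apply: vD => //; [exact: fD|exact: gD].
  - have -> : t *: f x + (1 - t) *: g x - (t *: f y + (1 - t) *: g y) =
        t *: (f x - f y) + (1 - t) *: (g x - g y).
      by rewrite !scalerBr opprD addrACA.
    apply: (le_trans (ler_normD _ _)); move/andP: t01 => [t0 t1].
    rewrite !normrZ ger0_norm// ger0_norm ?subr_ge0//.
    have := fN _ _ Dx Dy; have := gN _ _ Dx Dy => h1 h2.
    have : t * `|f x - f y| <= t * `|x - y| by rewrite ler_wpM2l.
    have : (1 - t) * `|g x - g y| <= (1 - t) * `|x - y|.
      by rewrite ler_wpM2l// subr_ge0.
    by lra.
  - by rewrite fF// gF// -scalerDl addrC subrK scale1r.
have near x e : D x -> 0 < e -> exists f, N f /\ exists2 p, F p & `|f x - p| < e.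
  move=> Dx e0.
  pose K := [set y | forall d : R, 0 < d -> exists2 f, N f & `|y - f x| < d].
  have KD : K `<=` D.
    move=> y Ky; apply: cD => d d0; have [f [fD _ _] fy] := Ky d d0.
    by exists (f x) => //; exact: fD.
  have [||||i|p [Kp Fp]] := hK K.
  - by exists x => d d0; exists id => //; rewrite subrr normr0.
  - apply/closed_setP => y hy d d0.
    have [z Kz yz] := hy _ (divr_gt0 d0 (ltr0n _ 2)).
    have [f Nf fz] := Kz _ (divr_gt0 d0 (ltr0n _ 2)).
    exists f => //; apply: (le_lt_trans (ler_distD z _ _)); lra.
  - apply/convex_setP => y z t Ky Kz t01 d d0.
    have [f Nf fy] := Ky d d0; have [g Ng gz] := Kz d d0.
    exists (fun x => t *: f x + (1 - t) *: g x); first exact: Nconv.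
    have -> : t *: y + (1 - t) *: z - (t *: f x + (1 - t) *: g x) =
        t *: (y - f x) + (1 - t) *: (z - g x).
      by rewrite !scalerBr opprD addrACA.
    apply: (le_lt_trans (ler_normD _ _)); move/andP: t01 => [t0 t1].
    rewrite !normrZ ger0_norm// ger0_norm ?subr_ge0//.
    (* The strict bound comes from the first summand, which vanishes for [t = 0]; there the second
       one is strict. *)
    have [->|tn0] := eqVneq t 0; first by rewrite mul0r add0r subr0 mul1r.
    have h1 : t * `|y - f x| < t * d by rewrite ltr_pM2l// lt_def tn0.
    have h2 : (1 - t) * `|z - g x| <= (1 - t) * d.
      by rewrite ler_wpM2l// ?subr_ge0// ltW.
    by lra.
  - exact: KD.
  - move=> y Ky d d0; have [f Nf fy] := Ky d d0.
    exists (s i \o f); first exact: Ncomp.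
    apply: le_lt_trans fy; apply: sN; first exact: KD.
    by case: Nf => fD _ _; exact: fD.
  - have [f Nf fp] := Kp e e0; exists f; split=> //; exists p; last by rewrite distrC.
    by split=> //; exact: KD.
have [c [a [Dc [a0 ca]]]] := separable_dense_seq D0 sD.
have /choice[h hh] : forall nf : nat * (Z -> Z), exists g, N nf.2 -> N g /\
    exists2 p, F p & `|g (nf.2 (c nf.1)) - p| < a nf.1.
  move=> [n f] /=; have [Nf|nNf] := pselect (N f); last by exists id.
  have Dfc : D (f (c n)) by case: Nf => fD _ _; exact/fD/Dc.
  by have [g [Ng gp]] := near _ _ Dfc (a0 n); exists g.
pose f := fix f n := if n is m.+1 then h (m, f m) \o f m else id.
have Nf n : N (f n).
  elim: n => //= n IH; apply: Ncomp => //; exact: (hh (n, f n) IH).1.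
have stab x p e n m : F p -> D x -> `|f n x - p| <= e -> (n <= m)%N ->
    `|f m x - p| <= e.
  move=> Fp Dx fxp; elim: m => [|m IH]; first by rewrite leqn0 => /eqP <-.
  rewrite leq_eqVlt => /orP[/eqP <- //|]; rewrite ltnS => /IH {}IH.
  have [[hD hN hF] _] := hh (m, f m) (Nf m).
  apply: le_trans IH; rewrite /= -[X in _ - X](hF p Fp).
  by apply: hN; [case: (Nf m) => fD _ _; exact: fD|case: Fp].
have conv x e : D x -> 0 < e -> exists n, exists2 p, F p &
    forall m, (n <= m)%N -> `|f m x - p| <= e.
  (* Stage [n.+1] brings [c n] within [a n] of [F], and [x] follows because [f n.+1] is
     nonexpansive. *)
  move=> Dx e0; have [n [xc an]] := ca x Dx _ (divr_gt0 e0 (ltr0n _ 2)).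
  have [_ [p Fp hp]] := hh (n, f n) (Nf n).
  exists n.+1, p => // m; apply: stab => //.
  apply: (le_trans (ler_distD (f n.+1 (c n)) _ _)).
  have [_ fN _] := Nf n.+1; have := fN _ _ Dx (Dc n); move: hp => /=; lra.
have cvgf x : exists l : Z, D x -> (fun n => f n x) @ \oo --> l.
  have [Dx|nDx] := pselect (D x); last by exists x.
  suff [l fl] : exists l : Z, (fun n => f n x) @ \oo --> l by exists l.
  apply: cauchy_seq_cvg => e e0; have [n [p Fp hn]] := conv x _ Dx (divr_gt0 e0 (ltr0n _ 2)).
  exists n => m nm; apply: (le_trans (ler_distD p _ _)).
  have := hn n (leqnn n); have := hn m nm; rewrite (distrC p); lra.
have /choice[r hr] := cvgf.
have rD x : D x -> D (r x).
  move=> Dx; apply: cD => e e0; have [n hn] := cvg_dist_lt (hr x Dx) e0.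
  by exists (f n x); [case: (Nf n) => fD _ _; exact: fD|exact: hn].
exists r; split.
- move=> x y Dx Dy; rewrite -subr_le0; apply: le0_of_le_eps => e e0.
  have [n hn] := cvg_dist_lt (hr x Dx) (divr_gt0 e0 (ltr0n _ 2)).
  have [m hm] := cvg_dist_lt (hr y Dy) (divr_gt0 e0 (ltr0n _ 2)).
  have := hn _ (leq_maxl n m); have := hm _ (leq_maxr n m).
  set k := maxn n m => h1 h2; have [_ fN _] := Nf k; have := fN _ _ Dx Dy.
  have := ler_distD (f k x) (r x) (r y); have := ler_distD (f k y) (f k x) (r y).
  rewrite (distrC (f k y)); lra.
- move=> x Dx; split; first exact: rD.
  move=> i; apply: dist_eq => e e0.
  have [n [p Fp hn]] := conv x _ Dx (divr_gt0 e0 (ltr0n _ 4)).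
  have [m hm] := cvg_dist_lt (hr x Dx) (divr_gt0 e0 (ltr0n _ 4)).
  have := hn _ (leq_maxl n m); have := hm _ (leq_maxr n m).
  set k := maxn n m => h1 h2.
  have rp : `|r x - p| <= e / 2 by have := ler_distD (f k x) (r x) p; lra.
  apply: (le_trans (ler_distD p _ _)); rewrite (distrC p).
  have : `|s i (r x) - p| <= `|r x - p|.
    by case: Fp => Dp sp; rewrite -[X in `|_ - X|](sp i); apply: sN => //; exact: rD.
  lra.
- move=> p [Dp sp]; apply: dist_eq => e e0.
  have [n hn] := cvg_dist_lt (hr p Dp) e0.
  have [_ _ fF] := Nf n; have := hn n (leqnn n); rewrite fF//; exact: ltW.
Qed.

End retraction.

Lemma geom_lt {R : realType} (c e : R) : 0 < e -> exists n : nat, c / 2 ^+ n < e.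
Proof.
move=> e0; have [c0|c0] := leP c 0.
  by exists 0%N; rewrite expr0 divr1; apply: le_lt_trans e0.
exists (Num.truncn (c / e)).+1; set n := (Num.truncn _).+1.
rewrite ltr_pdivrMr ?exprn_gt0// mulrC -ltr_pdivrMr//.
apply: (lt_trans (truncnS_gt _)); rewrite -natrX ltr_nat; exact: ltn_expl.
Qed.

Lemma half_dist {R : realType} {Y : normedModType R} (u v p : Y) :
  `|2^-1 *: u + 2^-1 *: v - p| <= 2^-1 * (`|u - p| + `|v - p|).
Proof.
have {1}-> : p = 2^-1 *: p + 2^-1 *: p.
  by rewrite -scalerDl (_ : 2^-1 + 2^-1 = 1) ?scale1r//; lra.
rewrite opprD addrACA -!scalerBr -scalerDr normrZ ger0_norm ?invr_ge0//.
by rewrite ler_wpM2l ?invr_ge0// ler_normD.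
Qed.

(** * Common fixed points of finite and countable commuting families *)

Section commuting.
Context {R : realType} {Z : completeNormedModType R}.
Hypothesis fppZ : FPP_nonexpansive Z.
Implicit Types (D K : set Z) (x y p : Z).

Definition commuting_nonexpansive I (s : I -> Z -> Z) D :=
  [/\ forall i, set_fun D D (s i), forall i, nonexpansive_on D (s i) &
      forall i j x, D x -> s i (s j x) = s j (s i x)].

(** Let [r] retract [D] onto the common fixed points of the first [n] maps. By commutation the last
    map preserves that set, so a fixed point of [s n \o r] lies in it, is fixed by [r], and hence by
    [s n]. *)
Lemma finite_common_fixed (s : nat -> Z -> Z) n D :
  D !=set0 -> bounded_set D -> closed D -> convex_set D -> separable_set D ->
  commuting_nonexpansive (fun i : 'I_n => s i) D ->
  common_fixed (fun i : 'I_n => s i) D !=set0.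
Proof.
elim: n D => [|n IH] D D0 bD cD vD sD [sDD sN sC].
  by have [x Dx] := D0; exists x; split=> // -[].
pose w (i : 'I_n) : 'I_n.+1 := widen_ord (leqnSn n) i.
have [] := @nonexpansive_retraction _ Z _ (fun i : 'I_n => s i) D D0 cD vD sD.
- by move=> i; apply: (sDD (w i)).
- by move=> i; apply: (sN (w i)).
- move=> K K0 cK vK KD sK; apply: IH => //.
  + have [M hM] := (bounded_setP D).1 bD.
    by apply/bounded_setP; exists M => x /KD; exact: hM.
  + by have [b hb] := sD; exists b => x /KD; exact: hb.
  + split=> // [i x y /KD Dx /KD Dy|i j x /KD Dx]; first exact: (sN (w i)).
    exact: (sC (w i) (w j)).
move=> r [rN rF rp].
have rD x : D x -> D (r x) by move=> /rF [].
have sn := sDD ord_max; have snN := sN ord_max.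
have [||x Dx /= sx] := fppZ D0 bD cD vD (T := s n \o r).
- by move=> x Dx /=; exact/sn/rD.
- move=> x y Dx Dy; exact: le_trans (snN _ _ (rD _ Dx) (rD _ Dy)) (rN _ _ Dx Dy).
have [_ rxF] := rF _ Dx.
have Fx : common_fixed (fun i : 'I_n => s i) D x.
  split=> // i; have := sC (w i) ord_max _ (rD _ Dx).
  by rewrite /= sx (rxF i : s (w i) (r x) = r x) sx.
exists x; split=> // i; have [ilt|] := ltnP i n; first exact: (Fx.2 (Ordinal ilt)).
move=> ni; have -> : (i : nat) = n by apply/eqP; rewrite eqn_leq ni -ltnS ltn_ord.
by rewrite -{1}(rp _ Fx).
Qed.

(** The retractions [r n] onto the fixed points of the first [n] maps have decreasing ranges. A
    fixed point of their weighted average with weights [2^-(n+1)] is shown to be fixed by each of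
    them. *)
Lemma countable_common_fixed (s : nat -> Z -> Z) D :
  D !=set0 -> bounded_set D -> closed D -> convex_set D -> separable_set D ->
  commuting_nonexpansive s D -> common_fixed s D !=set0.
Proof.
move=> D0 bD cD vD sD [sDD sN sC].
have /choice[r hr] : forall n, exists r : Z -> Z, [/\ nonexpansive_on D r,
    forall x, D x -> common_fixed (fun i : 'I_n => s i) D (r x) &
    forall p, common_fixed (fun i : 'I_n => s i) D p -> r p = p].
  move=> n; apply: nonexpansive_retraction => // K K0 cK vK KD sK.
  apply: finite_common_fixed => //.
  + have [M hM] := (bounded_setP D).1 bD.
    by apply/bounded_setP; exists M => x /KD; exact: hM.
  + by have [b hb] := sD; exists b => x /KD; exact: hb.
  + by split=> // [i x y /KD Dx /KD Dy|i j x /KD Dx]; [exact: sN|exact: sC].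
have rD n x : D x -> D (r n x) by move=> Dx; have [_ /(_ _ Dx)[]] := hr n.
have rr m n x : (m <= n)%N -> D x -> r m (r n x) = r n x.
  move=> mn Dx; have [_ /(_ _ Dx)[Drx h] _] := hr n; have [_ _ ->//] := hr m.
  by split=> // i; exact: (h (widen_ord mn i)).
(* Since [r n x = r m (r n x)], both points on the left are images under the nonexpansive [r m]. *)
have rdist m n x : (m <= n)%N -> D x -> `|r n x - r m x| <= `|x - r n x|.
  move=> mn Dx; rewrite -(rr m n x mn Dx) rr//.
  have [rN _ _] := hr m; have := rN _ _ (rD n _ Dx) Dx.
  by rewrite rr// distrC (distrC _ x).
have [M hM] := (bounded_setP D).1 bD.
have /closed_setP cD' := cD; have /convex_setP vD' := vD.
(* T N k is the N-th partial sum of 2^-1 r_k + 2^-2 r_k+1 + ..., completed into a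
   convex combination by giving the remaining weight to the last retraction *)
pose T := fix T N k x : Z :=
  if N is N'.+1 then 2^-1 *: r k x + (1 - 2^-1) *: T N' k.+1 x else r k x.
have half : 0 <= (2^-1 : R) <= 1 by lra.
have hE : 1 - 2^-1 = 2^-1 :> R by lra.
have TD N k x : D x -> D (T N k x).
  move=> Dx; elim: N k => [|N IH] k /=; first exact: rD.
  by apply: vD' => //; exact: rD.
have TN N k : nonexpansive_on D (T N k).
  move=> x y Dx Dy; elim: N k => [|N IH] k /=; first by have [rN _ _] := hr k; exact: rN.
  rewrite hE -!scalerDr -scalerBr normrZ opprD addrACA ger0_norm ?invr_ge0//.
  have := ler_normD (r k x - r k y) (T N k.+1 x - T N k.+1 y).
  have [rN _ _] := hr k; have := rN _ _ Dx Dy; have := IH k.+1.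
  set a := `|_ - _|; set b := `|_ - _|; set c := `|_ - _|; set d := `|_ + _|; lra.
(* The first [N] terms agree; what remains has weight [2^-N] and norm at most [M] on each side. *)
have TC N j k x : D x -> `|T (N + j)%N k x - T N k x| <= (2 * M) / 2 ^+ N.
  move=> Dx; elim: N k => [|N IH] k.
    rewrite expr0 divr1; apply: (le_trans (ler_normB _ _)).
    have := hM _ (TD (0 + j)%N k x Dx); have := hM _ (TD 0%N k x Dx); lra.
  rewrite addSn /= hE -!scalerDr -scalerBr opprD addrACA subrr add0r normrZ.
  rewrite ger0_norm ?invr_ge0// exprS invfM mulrCA ler_wpM2l ?invr_ge0//.
(* S (k, x) = sum_n 2^-(n+1) r_(k+n) x *)
have /choice[S hS] : forall kx : nat * Z, exists l : Z, D kx.2 ->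
    (fun N => T N kx.1 kx.2) @ \oo --> l.
  move=> [k x] /=; have [Dx|nDx] := pselect (D x); last by exists x.
  suff [l hl] : exists l : Z, (fun N => T N k x) @ \oo --> l by exists l.
  apply: cauchy_seq_cvg => e e0; have [N hN] := geom_lt (2 * M) e0.
  by exists N => n Nn; rewrite -(subnKC Nn); apply: le_trans (TC _ _ _ _ Dx) (ltW hN).
have SD k x : D x -> D (S (k, x)).
  move=> Dx; apply: cD' => e e0; have [n hn] := cvg_dist_lt (hS (k, x) Dx) e0.
  by exists (T n k x); [exact: TD|exact: hn].
have SN k : nonexpansive_on D (fun x => S (k, x)).
  move=> x y Dx Dy; rewrite -subr_le0; apply: le0_of_le_eps => e e0.
  have [n hn] := cvg_dist_lt (hS (k, x) Dx) (divr_gt0 e0 (ltr0n _ 2)).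
  have [m hm] := cvg_dist_lt (hS (k, y) Dy) (divr_gt0 e0 (ltr0n _ 2)).
  have := hn _ (leq_maxl n m); have := hm _ (leq_maxr n m) => /=.
  set q := maxn n m => h1 h2; have := TN q k _ _ Dx Dy.
  have := ler_distD (T q k x) (S (k, x)) (S (k, y)).
  have := ler_distD (T q k y) (T q k x) (S (k, y)).
  rewrite (distrC (T q k y)); lra.
have SE k x : D x -> S (k, x) = 2^-1 *: r k x + 2^-1 *: S (k.+1, x).
  move=> Dx; apply: dist_eq => e e0.
  have [n hn] := cvg_dist_lt (hS (k, x) Dx) (divr_gt0 e0 (ltr0n _ 2)).
  have [m hm] := cvg_dist_lt (hS (k.+1, x) Dx) (divr_gt0 e0 (ltr0n _ 2)).
  have := hn _ (leqW (leq_maxl n m)); have := hm _ (leq_maxr n m) => /=.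
  set q := maxn n m; rewrite hE => h1 h2.
  apply: (le_trans (ler_distD (2^-1 *: r k x + 2^-1 *: T q k.+1 x) _ _)).
  rewrite [X in _ + `|X|](_ : _ = 2^-1 *: (T q k.+1 x - S (k.+1, x))); last first.
    by rewrite opprD addrACA subrr add0r scalerBr.
  rewrite normrZ ger0_norm ?invr_ge0// (distrC (T q _ _)); lra.
have [x Dx Sx] := fppZ D0 bD cD vD (SD 0%N) (SN 0%N).
pose d n := `|x - r n x|.
(* if d m > B/2, descending induction on k <= m gives |S (k, x) - r m x| < d m,
   which is absurd at k = 0 since S (0, x) = x *)
have dB B : (forall n, d n <= B) -> forall m, d m <= B / 2.
  move=> hB m; rewrite leNgt; apply/negP => Bm.
  have TB N k : (m <= k)%N -> `|T N k x - r m x| <= B.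
    elim: N k => [|N IH] k mk /=; first exact: le_trans (rdist _ _ _ mk Dx) (hB k).
    rewrite hE; apply: (le_trans (half_dist _ _ _)).
    have := IH k.+1 (leqW mk); have := rdist _ _ _ mk Dx; have := hB k; rewrite /d; lra.
  (* The leading term of [S (m, x)] is [r m x] itself, so only the tail, of weight one half,
     contributes. *)
  have Sm : `|S (m, x) - r m x| <= B / 2.
    rewrite SE//; apply: (le_trans (half_dist _ _ _)); rewrite subrr normr0 add0r.
    suff : `|S (m.+1, x) - r m x| <= B by lra.
    rewrite -subr_le0; apply: le0_of_le_eps => e e0.
    have [n hn] := cvg_dist_lt (hS (m.+1, x) Dx) e0.
    have := hn _ (leqnn n) => /=; have := TB n m.+1 (leqnSn m).
    have := ler_distD (T n m.+1 x) (S (m.+1, x)) (r m x); lra.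
  have Sk j : (j <= m)%N -> `|S ((m - j)%N, x) - r m x| < d m.
    elim: j => [|j IH] jm; first by rewrite subn0; lra.
    rewrite SE//; apply: (le_lt_trans (half_dist _ _ _)).
    have := IH (ltnW jm); rewrite subnSK//.
    have := rdist (m - j.+1)%N m x (leq_subr _ _) Dx; rewrite distrC -/(d m); lra.
  by have := Sk m (leqnn m); rewrite subnn Sx ltxx.
(* With [B] the supremum of [d], the halving bound says that the supremum is at most half of
   itself. *)
have d0 m : d m <= 0.
  have hs : has_sup (range d).
    split; first by exists (d 0%N); exists 0%N.
    exists (2 * M) => _ [n _ <-]; apply: (le_trans (ler_normB _ _)).
    have := hM _ Dx; have := hM _ (rD n _ Dx); lra.
  have dsup n : d n <= sup (range d) by apply: sup_upper_bound => //; exists n.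
  have : sup (range d) <= sup (range d) / 2.
    by apply: ge_sup => [|_ [n _ <-]]; [exists (d 0%N); exists 0%N|exact: dB].
  have := dsup m; lra.
exists x; split=> // i.
(* The range of [r n] is fixed by the maps of index below [n], so [s i] calls for [r i.+1]. *)
have : r i.+1 x = x.
  by apply/eqP; rewrite eq_sym -subr_eq0 -normr_le0; exact: d0.
by have [_ /(_ _ Dx)[_ h] _] := hr i.+1 => <-; exact: (h ord_max).
Qed.

End commuting.

(* Names for the points obtained from one point by rational convex combinations and by
   the maps [s (c z)], where [s (c z)] moves [z]: [LSApp t1 t2] stands for
   [s (c z1) z2] when [ti] stands for [zi]. *)
Inductive lsterm : Type :=
  | LSBase
  | LSApp of lsterm & lsterm
  | LSComb of rat & lsterm & lsterm.

(** The encoding makes terms countable, so that [pickle] and [unpickle] can enumerate the named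
    points and the maps attached to them. *)
Fixpoint lsterm_encode t : GenTree.tree rat :=
  match t with
  | LSBase => GenTree.Leaf 0
  | LSApp t1 t2 => GenTree.Node 0 [:: lsterm_encode t1; lsterm_encode t2]
  | LSComb q t1 t2 =>
      GenTree.Node 1 [:: GenTree.Leaf q; lsterm_encode t1; lsterm_encode t2]
  end.

Fixpoint lsterm_decode g : lsterm :=
  match g with
  | GenTree.Node 0 [:: g1; g2] => LSApp (lsterm_decode g1) (lsterm_decode g2)
  | GenTree.Node 1 [:: GenTree.Leaf q; g1; g2] =>
      LSComb q (lsterm_decode g1) (lsterm_decode g2)
  | _ => LSBase
  end.

Lemma lsterm_encodeK : cancel lsterm_encode lsterm_decode.
Proof. by elim=> //= [t1 -> t2 ->|q t1 -> t2 ->]. Qed.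

HB.instance Definition _ := Countable.copy lsterm (can_type lsterm_encodeK).

(** * Approximate common fixed points of arbitrary commuting families *)

Section approximate_common_fixed.
Context {R : realType} {Z : completeNormedModType R}.
Hypothesis fppZ : FPP_nonexpansive Z.

(** If every [z] is moved by more than [e] by some [s (c z)], close one point under rational convex
    combinations and these witness maps. The closure is separable, and the countably many witness
    maps of named points have a common fixed point in it. A named point within [e / 2] of that fixed
    point is moved by at most [e] by its own witness map, a contradiction. *)
Lemma approximate_common_fixed I (s : I -> Z -> Z) (D : set Z) (e : R) :
  D !=set0 -> bounded_set D -> closed D -> convex_set D ->
  commuting_nonexpansive s D -> 0 < e ->
  exists2 z, D z & forall i, `|s i z - z| <= e.
Proof.
move=> [x0 Dx0] bD /closed_setP cD /convex_setP vD [sDD sN sC] e0.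
apply: contrapT => nz.
have bad z : D z -> exists i, e < `|s i z - z|.
  move=> Dz; apply: contrapT => ni; apply: nz; exists z => // i.
  by rewrite leNgt; apply/negP => ei; apply: ni; exists i.
have [i0 _] := bad _ Dx0.
have /choice[c hc] : forall z, exists i, D z -> e < `|s i z - z|.
  by move=> z; have [/bad[i ei]|nDz] := pselect (D z); [exists i|exists i0].
pose ev := fix ev t : Z := match t with
  | LSBase => x0
  | LSApp t1 t2 => s (c (ev t1)) (ev t2)
  (* The guard keeps every value in [D], whatever the rational in the term. *)
  | LSComb q t1 t2 => if 0 <= q <= 1 then ratr q *: ev t1 + (1 - ratr q) *: ev t2
                      else x0
  end.
have Dev t : D (ev t).
  elim: t => //= [t1 IH1 t2 IH2|q t1 IH1 t2 IH2]; first exact: sDD.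
  case: ifP => // /andP[q0 q1]; apply: vD => //.
  by rewrite ler0q q0 -[X in _ <= X](rmorph1 (@ratr R)) ler_rat.
pose A := [set x | forall d : R, 0 < d -> exists t, `|x - ev t| < d].
have evA t : A (ev t) by move=> d d0; exists t; rewrite subrr normr0.
have AD : A `<=` D.
  by move=> x Ax; apply: cD => d d0; have [t xt] := Ax d d0; exists (ev t).
pose u n := s (c (ev (odflt LSBase (unpickle n)))).
have [||||||x [Ax ux]] := @countable_common_fixed _ _ fppZ u A.
- by exists x0; exact: (evA LSBase).
- have [M hM] := (bounded_setP D).1 bD.
  by apply/bounded_setP; exists M => x /AD; exact: hM.
- apply/closed_setP => x hx d d0.
  have [y Ay xy] := hx _ (divr_gt0 d0 (ltr0n _ 2)).
  have [t yt] := Ay _ (divr_gt0 d0 (ltr0n _ 2)).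
  by exists t; apply: (le_lt_trans (ler_distD y _ _)); lra.
- apply/convex_setP => x y t Ax Ay /andP[t0 t1] d d0.
  have [t1' xt] := Ax _ (divr_gt0 d0 (ltr0n _ 4)).
  have [t2' yt] := Ay _ (divr_gt0 d0 (ltr0n _ 4)).
  pose m := `|x| + `|y| + 1.
  have m0 : 0 < m by rewrite /m ltr_wpDl// addr_ge0.
  (* A rational weight within [h] of [t] costs at most [h * m = d / 4], as [|x - y| <= m]; replacing
     [x] and [y] by named points costs another [d / 4]. *)
  pose h := d / (4 * m).
  have h0 : 0 < h by rewrite divr_gt0// mulr_gt0.
  have [q] := @rat_in_itvoo R (Num.max 0 (t - h)) (Num.min 1 (t + h))
    ltac:(by rewrite gt_max !lt_min; lra).
  rewrite in_itv /= gt_max lt_min => /andP[/andP[q0 tq] /andP[q1 qt]].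
  exists (LSComb q t1' t2') => /=.
  have -> : 0 <= q <= 1.
    by rewrite -(ler0q R) -(ler_rat R) rmorph1 !ltW.
  set x' := ev t1' in xt *; set y' := ev t2' in yt *; set r : R := ratr q in q0 q1 tq qt *.
  have -> : t *: x + (1 - t) *: y - (r *: x' + (1 - r) *: y') =
      (t - r) *: (x - y) + (r *: (x - x') + (1 - r) *: (y - y')).
    have tx : t *: x = (t - r) *: x + r *: x by rewrite -scalerDl subrK.
    have ty : (1 - t) *: y = - ((t - r) *: y) + (1 - r) *: y.
      by rewrite -scaleNr -scalerDl; congr (_ *: _); ring.
    rewrite tx ty (addrACA ((t - r) *: x)) -(addrA ((t - r) *: x - _)) opprD.
    by rewrite (addrACA (r *: x)) -!scalerBr.
  apply: (le_lt_trans (ler_normD _ _)).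
  have h1 : `|(t - r) *: (x - y)| <= d / 4.
    rewrite normrZ; have -> : d / 4 = h * m by rewrite /h; field; rewrite gt_eqF.
    apply: ler_pM => //; first by rewrite ler_norml; lra.
    by apply: (le_trans (ler_normB _ _)); rewrite /m lerDl.
  have h2 : `|r *: (x - x') + (1 - r) *: (y - y')| <= d / 4.
    apply: (le_trans (ler_normD _ _)); rewrite (normrZ r) (normrZ (1 - r)).
    rewrite (ger0_norm (ltW q0)) ger0_norm ?subr_ge0 ?(ltW q1)//.
    have -> : d / 4 = r * (d / 4) + (1 - r) * (d / 4) by ring.
    by apply: lerD; apply: ler_wpM2l; rewrite ?subr_ge0 ltW.
  lra.
- by exists (fun n => ev (odflt LSBase (unpickle n))) => x Ax d d0;
    have [t xt] := Ax d d0; exists (pickle t); rewrite pickleK.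
- split=> [n x Ax d d0|n x y /AD Dx /AD Dy|n m x /AD Dx]; [|exact: sN|exact: sC].
  (* [LSApp] names the image of a named point under [u n], so nonexpansiveness makes the closure
     invariant. *)
  have [t xt] := Ax d d0; exists (LSApp (odflt LSBase (unpickle n)) t).
  by apply: le_lt_trans xt; apply: sN => //; exact: AD.
have [t xt] := Ax _ (divr_gt0 e0 (ltr0n _ 2)).
have := hc _ (Dev t); rewrite ltNge => /negP; apply.
have := ux (pickle t); rewrite /u pickleK /= => sx.
apply: (le_trans (ler_distD x _ _)).
have : `|s (c (ev t)) (ev t) - x| <= `|ev t - x|.
  by rewrite -[X in `|_ - X|]sx; apply: sN => //; exact: AD.
rewrite (distrC (ev t)); lra.
Qed.

End approximate_common_fixed.

(** * Ultrapowers *)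

(** Completeness is required only for sequences with geometrically small steps; this suffices for
    the quotient by the null space to be Banach. *)
Record seminorm (R : realType) (V : lmodType R) := Seminorm {
  snorm :> V -> R;
  snormD : forall x y, snorm (x + y) <= snorm x + snorm y;
  snormZ : forall a x, snorm (a *: x) = `|a| * snorm x;
  snorm_complete : forall u : nat -> V,
    (forall n, snorm (u n.+1 - u n) <= 2^-1 ^+ n) ->
    exists l, forall e : R, 0 < e -> exists N, forall n, (N <= n)%N -> snorm (u n - l) <= e
}.

(** * The Banach space obtained from a complete seminorm by dividing out its null space *)

Section separation_quotient.
Context {R : realType} {V : lmodType R} (p : seminorm V).
Local Open Scope quotient_scope.
Implicit Types x y z : V.

Lemma snorm0 : p 0 = 0.
Proof. by rewrite -(scale0r 0) snormZ normr0 mul0r. Qed.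

Lemma snormN x : p (- x) = p x.
Proof. by rewrite -scaleN1r snormZ normrN1 mul1r. Qed.

Lemma snorm_distC x y : p (x - y) = p (y - x).
Proof. by rewrite -snormN opprB. Qed.

Lemma snorm_ge0 x : 0 <= p x.
Proof. by have := snormD p x (- x); rewrite subrr snorm0 snormN; lra. Qed.

Lemma snorm_distD z x y : p (x - y) <= p (x - z) + p (z - y).
Proof. by rewrite -{1}(subrK z x) -addrA snormD. Qed.

Lemma snorm_eq x y : p (x - y) = 0 -> p x = p y.
Proof.
move=> xy; have := snormD p (x - y) y; have := snormD p (y - x) x.
by rewrite !subrK (snorm_distC y) xy !add0r; lra.
Qed.

Definition null_rel x y := p (x - y) == 0.

Lemma null_rel_refl : reflexive null_rel.
Proof. by move=> x; rewrite /null_rel subrr snorm0. Qed.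

Lemma null_rel_sym : symmetric null_rel.
Proof. by move=> x y; rewrite /null_rel snorm_distC. Qed.

Lemma null_rel_trans : transitive null_rel.
Proof.
move=> y x z /eqP xy /eqP yz; apply/eqP.
by have := snorm_distD y x z; have := snorm_ge0 (x - z); lra.
Qed.

Canonical null_equiv := EquivRel null_rel null_rel_refl null_rel_sym null_rel_trans.

Definition sepq : Type := {eq_quot null_rel}.
HB.instance Definition _ := Choice.on sepq.
HB.instance Definition _ := EqQuotient.on sepq.

Definition toq x : sepq := \pi_sepq x.

Lemma toqP x y : toq x = toq y <-> p (x - y) = 0.
Proof.
split=> [/eqP|xy]; first by rewrite /toq eqmodE => /eqP.
by apply/eqP; rewrite /toq eqmodE; apply/eqP.
Qed.

Lemma toqK (a : sepq) : toq (repr a) = a.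
Proof. exact: reprK. Qed.

Lemma repr_toq x : p (repr (toq x) - x) = 0.
Proof. by apply/toqP; rewrite toqK. Qed.

Definition sq_add (a b : sepq) := toq (repr a + repr b).
Definition sq_opp (a : sepq) := toq (- repr a).
Definition sq_scale (k : R) (a : sepq) := toq (k *: repr a).
Definition sq_norm (a : sepq) := p (repr a).

Lemma toqD x y : sq_add (toq x) (toq y) = toq (x + y).
Proof.
apply/toqP; rewrite opprD addrACA; apply/eqP; rewrite eq_le snorm_ge0 andbT.
by apply: (le_trans (snormD _ _ _)); rewrite !repr_toq addr0.
Qed.

Lemma toqN x : sq_opp (toq x) = toq (- x).
Proof. by apply/toqP; rewrite -opprD snormN repr_toq. Qed.

Lemma toqZ k x : sq_scale k (toq x) = toq (k *: x).
Proof. by apply/toqP; rewrite -scalerBr snormZ repr_toq mulr0. Qed.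

Lemma sq_addA : associative sq_add.
Proof.
move=> a b c; rewrite -(toqK a) -(toqK b) -(toqK c).
by rewrite !toqD addrA.
Qed.

Lemma sq_addC : commutative sq_add.
Proof. by move=> a b; rewrite -(toqK a) -(toqK b) !toqD addrC. Qed.

Lemma sq_add0 : left_id (toq 0) sq_add.
Proof. by move=> a; rewrite -(toqK a) toqD add0r. Qed.

Lemma sq_addN : left_inverse (toq 0) sq_opp sq_add.
Proof. by move=> a; rewrite -(toqK a) toqN toqD addNr. Qed.

HB.instance Definition _ := GRing.isZmodule.Build sepq sq_addA sq_addC sq_add0 sq_addN.

Lemma toq_add x y : toq x + toq y = toq (x + y). Proof. exact: toqD. Qed.

Lemma sq_scaleA k l (a : sepq) : sq_scale k (sq_scale l a) = sq_scale (k * l) a.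
Proof. by rewrite -(toqK a) !toqZ scalerA. Qed.

Lemma sq_scale1 : left_id 1 sq_scale.
Proof. by move=> a; rewrite -(toqK a) toqZ scale1r. Qed.

Lemma sq_scaleDr : right_distributive sq_scale +%R.
Proof.
by move=> k a b; rewrite -(toqK a) -(toqK b) !(toq_add, toqZ) scalerDr.
Qed.

Lemma sq_scaleDl (a : sepq) : {morph sq_scale^~ a : k l / k + l}.
Proof. by move=> k l; rewrite /= -(toqK a) !(toq_add, toqZ) scalerDl. Qed.

HB.instance Definition _ := GRing.Zmodule_isLmodule.Build R sepq
  sq_scaleA sq_scale1 sq_scaleDr sq_scaleDl.

Lemma sq_normE x : sq_norm (toq x) = p x.
Proof. by apply: snorm_eq; rewrite repr_toq. Qed.

Lemma sq_normD (a b : sepq) : sq_norm (a + b) <= sq_norm a + sq_norm b.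
Proof. by rewrite -(toqK a) -(toqK b) toq_add !sq_normE snormD. Qed.

Lemma sq_normZ k (a : sepq) : sq_norm (k *: a) = `|k| * sq_norm a.
Proof. by rewrite -(toqK a) [k *: _]toqZ !sq_normE snormZ. Qed.

Lemma sq_norm0 (a : sepq) : sq_norm a = 0 -> a = 0.
Proof. by rewrite -(toqK a) sq_normE => pa; apply/toqP; rewrite subr0. Qed.

HB.instance Definition _ := Lmodule_isNormed.Build R sepq sq_normD sq_normZ sq_norm0.

Lemma toq_normE x : `|toq x| = p x. Proof. exact: sq_normE. Qed.

Lemma toq_linear : linear toq.
Proof. by move=> k x y; rewrite -toqD -toqZ. Qed.

HB.instance Definition _ := GRing.isLinear.Build R V sepq *:%R toq toq_linear.

(** A Cauchy filter contains balls of radius [2^-n / 4]. Consecutive ones meet, so representatives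
    of their centres have the steps that [snorm_complete] asks for. *)
Lemma sepq_complete (F : set_system sepq) : ProperFilter F -> cauchy F -> cvg F.
Proof.
move=> PF /cauchyP cF.
have h2 n : 0 < (2^-1 : R) ^+ n by rewrite exprn_gt0// invr_gt0.
have /choice[c hc] : forall n : nat, exists a : sepq, F (ball a (2^-1 ^+ n / 4)).
  by move=> n; apply: cF; rewrite divr_gt0 ?exprn_gt0.
have cc n : `|c n.+1 - c n| <= 2^-1 ^+ n.
  have [a [Fn Fn1]] := filter_ex (filterI (hc n) (hc n.+1)).
  move: Fn Fn1; rewrite -!ball_normE /= => Fn Fn1.
  have := ler_distD a (c n.+1) (c n); rewrite (distrC a).
  by move: Fn Fn1; rewrite exprS; have := h2 n; lra.
have [|l hl] := snorm_complete (s := p) (u := fun n => repr (c n)).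
  by move=> n; rewrite -toq_normE raddfB /= !toqK.
have dl n : `|c n - toq l| = p (repr (c n) - l).
  by rewrite -toq_normE raddfB /= toqK.
apply/cvg_ex; exists (toq l); apply/cvg_ballP => e e0.
have [N hN] := hl _ (divr_gt0 e0 (ltr0n _ 2)).
have [M hM] := geom_lt 1 (divr_gt0 e0 (ltr0n _ 2)).
set n := maxn N M.
apply: filterS (hc n) => a; rewrite -!ball_normE /= => can.
apply: (le_lt_trans (ler_distD (c n) _ _)).
have := hN n (leq_maxl _ _); rewrite -dl distrC.
have : (2^-1 : R) ^+ n <= 2^-1 ^+ M.
  by rewrite ler_wiXn2l ?leq_maxr//; lra.
move: hM; rewrite mul1r -exprVn.
have := h2 n.
set u := _ ^+ M; set v := _ ^+ n in can *; lra.
Qed.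

HB.instance Definition _ := Uniform_isComplete.Build sepq sepq_complete.

End separation_quotient.

(** * Limits along a free ultrafilter on the natural numbers *)

Definition ufilter : set_system nat := sval (cid (ultraFilterLemma eventually_filter)).

Lemma ufilter_ultra : UltraFilter ufilter.
Proof. by rewrite /ufilter; case: cid => F [] . Qed.
#[local] Existing Instance ufilter_ultra.

Lemma ufilter_ge (N : nat) : ufilter [set n | (N <= n)%N].
Proof.
rewrite /ufilter; case: cid => F [_ /=]; apply.
by exists N.
Qed.

Lemma ultra_fmap (S T : Type) (f : S -> T) (F : set_system S) :
  UltraFilter F -> UltraFilter (f @ F).
Proof.
move=> UF; split; first exact: fmap_proper_filter.
move=> G PG FG; rewrite predeqE => A; split; last exact: FG.
move=> GA; have [//|FnA] := in_ultra_setVsetC (f @^-1` A) UF.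
have GnA : G (~` A) by exact: FG.
by have [x []] := filter_ex (filterI GA GnA).
Qed.

Section ulim.
Context {R : realType}.
Implicit Types a b : nat -> R.

Definition ulim a : R := lim (a @ ufilter).

(** The image of an ultrafilter is an ultrafilter, and on the compact segment from [- M] to [M] it
    converges. *)
Lemma ulim_cvg a M : (forall n, `|a n| <= M) -> a @ ufilter --> ulim a.
Proof.
move=> aM; apply/cvg_ex.
have := @segment_compact R (- M) M; rewrite compact_ultra => /(_ (a @ ufilter)).
case; first exact: ultra_fmap.
  by apply: (@filterE _ ufilter) => n /=; rewrite in_itv /= -ler_norml aM.
by move=> l [_ al]; exists l.
Qed.

Lemma ulim_le a M c : (forall n, `|a n| <= M) -> ufilter [set n | a n <= c] ->
  ulim a <= c.
Proof. by move=> /ulim_cvg/cvgP ca ac; apply: limr_le. Qed.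

Lemma ulim_lt a M c : (forall n, `|a n| <= M) -> ulim a < c ->
  ufilter [set n | a n < c].
Proof. by move=> /ulim_cvg ca; exact: (cvgr_lt _ ca). Qed.

End ulim.

(** * The complete seminorm on bounded sequences given by the ultrafilter limit of the norms *)

Section bounded_sequences.
Context {R : realType} {Y : completeNormedModType R}.

Definition bounded_seq : {pred nat -> Y} :=
  mem [set x : nat -> Y | exists M : R, forall n, `|x n| <= M].

Lemma bounded_seqP (x : nat -> Y) : x \in bounded_seq <-> exists M : R, forall n, `|x n| <= M.
Proof. by split=> [/set_mem|h]; last exact/mem_set. Qed.

Lemma bounded_seq_submod : submod_closed bounded_seq.
Proof.
split=> [|a x y /bounded_seqP[M hM] /bounded_seqP[N hN]]; apply/bounded_seqP.
  by exists 0 => n; rewrite normr0.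
exists (`|a| * M + N) => n; apply: (le_trans (ler_normD _ _)).
by rewrite normrZ lerD// ler_wpM2l.
Qed.

HB.instance Definition _ := GRing.isSubmodClosed.Build R (nat -> Y) bounded_seq bounded_seq_submod.

Definition bounded_seqs : Type := {x : nat -> Y | x \in bounded_seq}.
HB.instance Definition _ := SubType.on bounded_seqs.
HB.instance Definition _ := Choice.on bounded_seqs.
HB.instance Definition _ := [SubChoice_isSubLmodule of bounded_seqs by <:].

Definition unorm (x : bounded_seqs) : R := ulim (fun n => `|val x n|).

Lemma bounded_seq_bound (x : bounded_seqs) : exists M : R, forall n, `| `|val x n| | <= M.
Proof.
have /bounded_seqP[M hM] := valP x.
by exists M => n; rewrite normr_id.
Qed.

Lemma unorm_cvg (x : bounded_seqs) : (fun n => `|val x n|) @ ufilter --> unorm x.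
Proof. by have [M hM] := bounded_seq_bound x; exact: ulim_cvg hM. Qed.

Lemma unorm_le (x : bounded_seqs) c : ufilter [set n | `|val x n| <= c] -> unorm x <= c.
Proof. by have [M hM] := bounded_seq_bound x; exact: ulim_le hM. Qed.

Lemma unorm_lt (x : bounded_seqs) c : unorm x < c -> ufilter [set n | `|val x n| < c].
Proof. by have [M hM] := bounded_seq_bound x; exact: ulim_lt hM. Qed.

Lemma unormD x y : unorm (x + y) <= unorm x + unorm y.
Proof.
apply/ler_addgt0Pr => e e0; apply: unorm_le.
have hx : unorm x < unorm x + e / 2 by lra.
have hy : unorm y < unorm y + e / 2 by lra.
apply: filterS2 (unorm_lt hx) (unorm_lt hy) => n /= xn yn.
by apply: (le_trans (ler_normD _ _)); lra.
Qed.

Lemma unormZ a x : unorm (a *: x) = `|a| * unorm x.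
Proof.
have -> : unorm (a *: x) = ulim (fun n => `|a| * `|val x n|).
  by congr ulim; apply/funext => n; rewrite -normrZ.
apply: cvg_lim => //; apply: cvgMr; exact: unorm_cvg.
Qed.

Lemma unorm_complete (u : nat -> bounded_seqs) :
  (forall n, unorm (u n.+1 - u n) <= 2^-1 ^+ n) ->
  exists l, forall e : R, 0 < e -> exists N, forall n, (N <= n)%N -> unorm (u n - l) <= e.
Proof.
move=> hu.
have h2 n : 0 < (2^-1 : R) ^+ n by rewrite exprn_gt0// invr_gt0.
(* dropping the large jumps of u, which occur on a null set of indices, turns
   convergence along the ultrafilter into uniform convergence *)
pose d n i := val (u n.+1) i - val (u n) i.
pose t n i := if `|d n i| < 2 * 2^-1 ^+ n then d n i else 0.
pose v := fix v n i := if n is m.+1 then v m i + t m i else val (u 0%N) i.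
(* The right side is the exact sum of the step bounds [2 * 2^-j] for [j] from [n] to [n + k - 1]. *)
have vk n k i : `|v (n + k)%N i - v n i| <= 4 * 2^-1 ^+ n - 4 * 2^-1 ^+ (n + k).
  elim: k => [|k IH]; first by rewrite addn0 !subrr normr0.
  rewrite addnS /= addrAC; apply: (le_trans (ler_normD _ _)).
  have : `|t (n + k)%N i| <= 2 * 2^-1 ^+ (n + k).
    rewrite /t; case: ifP => [/ltW//|_]; rewrite normr0.
    by have := h2 (n + k)%N; lra.
  by rewrite exprS; move: IH; lra.
have vk' n k i : `|v (n + k)%N i - v n i| <= 4 * 2^-1 ^+ n.
  by apply: (le_trans (vk n k i)); have := h2 (n + k)%N; lra.
have /choice[w hw] : forall i, exists l : Y, (fun n => v n i) @ \oo --> l.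
  move=> i; apply: cauchy_seq_cvg => e e0.
  have [N hN] := geom_lt 4 e0; exists N => n Nn; rewrite -(subnKC Nn).
  by apply: (le_trans (vk' N _ i)); rewrite exprVn ltW.
have vw n i : `|v n i - w i| <= 4 * 2^-1 ^+ n.
  apply/ler_addgt0Pr => e e0; have [m hm] := cvg_dist_lt (hw i) e0.
  have := hm _ (leq_maxr n m); set q := maxn n m => hq.
  have := vk' n (q - n)%N i; rewrite subnKC ?leq_maxl// => h.
  have := ler_distD (v q i) (v n i) (w i); rewrite (distrC (v q i) (w i)) (distrC (v n i) (v q i)); lra.
have wb : w \in bounded_seq.
  apply/bounded_seqP; have /bounded_seqP[M hM] := valP (u 0%N); exists (M + 4) => i.
  have h : `|val (u 0%N) i - w i| <= 4 by have := vw 0%N i; rewrite expr0 mulr1.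
  rewrite -[w i](subKr (val (u 0%N) i)); apply: (le_trans (ler_normB _ _)).
  by apply: lerD h; exact: hM.
(* Only finitely many truncations precede stage [n], and each is inactive on a set of the
   ultrafilter. *)
have uv n : ufilter [set i | v n i = val (u n) i].
  elim: n => [|n IH]; first exact: filterE.
  have : unorm (u n.+1 - u n) < 2 * 2^-1 ^+ n by have := hu n; have := h2 n; lra.
  move=> /unorm_lt h; apply: filterS2 IH h => i /= -> di.
  by rewrite /t /d ifT// addrC subrK.
exists (Sub w wb) => e e0; have [N hN] := geom_lt 4 e0; exists N => n Nn.
apply: unorm_le; apply: filterS (uv n) => i vu.
rewrite /mkset (_ : val _ i = v n i - w i); last by rewrite vu.
apply: (le_trans (vw n i)); apply: le_trans (ltW hN).
by rewrite exprVn ler_pM2l// -!exprVn ler_wiXn2l//; lra.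
Qed.

Definition ultra_seminorm : seminorm bounded_seqs := Seminorm unormD unormZ unorm_complete.

End bounded_sequences.
Arguments bounded_seqs : clear implicits.
Arguments bounded_seqs {R}.

(** * The ultrapower, its classes and representatives *)

Section ultrapower.
Context {R : realType}.
Variable Y : completeNormedModType R.

Definition ultrapower : completeNormedModType R := sepq (@ultra_seminorm R Y).

(** Total on all sequences: an unbounded one is sent to the zero class, hence the boundedness
    hypotheses below. *)
Definition ucls (x : nat -> Y) : ultrapower := toq ultra_seminorm (insubd 0 x).
Definition urep (z : ultrapower) : nat -> Y := val (repr z : bounded_seqs Y).

Lemma urep_bounded z : urep z \in bounded_seq.
Proof. exact: valP. Qed.

Lemma urepK z : ucls (urep z) = z.
Proof. by rewrite /ucls valKd [LHS]toqK. Qed.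

Lemma ucls_linear a (x y : nat -> Y) : x \in bounded_seq -> y \in bounded_seq ->
  ucls (fun n => a *: x n + y n) = a *: ucls x + ucls y.
Proof.
move=> bx by_; rewrite -linearP; congr toq; apply: val_inj.
rewrite insubdK /=; first by apply/funext => n; rewrite fctE !insubdK.
by have [_] := @bounded_seq_submod R Y => /(_ a _ _ bx by_).
Qed.

Lemma ucls_sum I (r : seq I) (c : I -> R) (x : I -> nat -> Y) :
  (forall j, x j \in bounded_seq) ->
  (fun i => \sum_(j <- r) c j *: x j i) \in bounded_seq /\
  ucls (fun i => \sum_(j <- r) c j *: x j i) = \sum_(j <- r) c j *: ucls (x j).
Proof.
move=> bx; have [b0 bL] := @bounded_seq_submod R Y.
elim: r => [|j r [IHb IHe]].
  under eq_fun do rewrite big_nil.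
  rewrite big_nil; split; first exact: b0.
  have := ucls_linear (-1) b0 b0; rewrite scaleN1r addNr => <-.
  by congr ucls; apply/funext => i; rewrite scaler0 addr0.
under eq_fun do rewrite big_cons.
rewrite big_cons; split; last by rewrite ucls_linear// IHe.
exact: (bL (c j) _ _ (bx j) IHb).
Qed.

Lemma ucls_cvg x : x \in bounded_seq -> (fun n => `|x n|) @ ufilter --> `|ucls x|.
Proof.
move=> bx; have := @unorm_cvg R Y (insubd 0 x).
by rewrite insubdK// -[unorm _]/(ultra_seminorm _) -toq_normE.
Qed.

Lemma ucls_le x c : x \in bounded_seq -> ufilter [set n | `|x n| <= c] -> `|ucls x| <= c.
Proof. by move=> /ucls_cvg cx xc; rewrite -(cvg_lim _ cx)//; apply: limr_le => //; apply: cvgP cx. Qed.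

Lemma ucls_lt x c : x \in bounded_seq -> `|ucls x| < c -> ufilter [set n | `|x n| < c].
Proof. by move=> /ucls_cvg cx; exact: (cvgr_lt _ cx). Qed.

End ultrapower.

(** * Finite representability of the ultrapower *)

Lemma independent_generators (R : fieldType) (V : lmodType R) n (b : 'I_n -> V) :
  exists m (b' : 'I_m -> V),
    range (fun c : 'I_n -> R => \sum_(i < n) c i *: b i) =
    range (fun c : 'I_m -> R => \sum_(i < m) c i *: b' i) /\
    forall c : 'I_m -> R, \sum_(i < m) c i *: b' i = 0 -> forall i, c i = 0.
Proof.
elim: n b => [|n IH] b; first by exists 0%N, b; split=> // c _ [].
have [ind|] := pselect (forall c : 'I_n.+1 -> R,
    \sum_(i < n.+1) c i *: b i = 0 -> forall i, c i = 0); first by exists n.+1, b.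
move=> /existsNP[c /not_implyP[cb /existsNP[j /eqP cj]]].
have [m [b' [Eb' ib']]] := IH (fun i => b (lift j i)).
exists m, b'; split=> //; rewrite -Eb'; apply/seteqP; split=> _ [a _ <-].
  (* Subtracting [a j / c j] times the relation [c] leaves the sum unchanged and cancels the
     coefficient of [b j]. *)
  pose a' i := a i - a j / c j * c i.
  exists (fun i => a' (lift j i)) => //.
  have -> : \sum_(i < n.+1) a i *: b i = \sum_(i < n.+1) a' i *: b i.
    have : a j / c j *: (\sum_(i < n.+1) c i *: b i) = 0 by rewrite cb scaler0.
    rewrite scaler_sumr => h; rewrite -[LHS]subr0 -[X in _ - X]h -sumrB.
    by apply: eq_bigr => i _; rewrite scalerA scalerBl.
  by rewrite [RHS](bigD1_ord j)//= /a' divfK// subrr scale0r add0r.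
exists (fun i => if unlift j i is Some k then a k else 0) => //.
rewrite (bigD1_ord j)//= unlift_none scale0r add0r.
by apply: eq_bigr => i _; rewrite liftK.
Qed.

Lemma combination_submod (R : pzRingType) (V : lmodType R) n (b : 'I_n -> V) :
  submod_closed [pred x in range (fun c : 'I_n -> R => \sum_(i < n) c i *: b i)].
Proof.
split=> [|a u v]; rewrite !inE.
  by exists (fun=> 0) => //; rewrite big1// => i _; rewrite scale0r.
move=> [c _ <-] [d _ <-]; exists (fun i => a * c i + d i) => //.
rewrite scaler_sumr -big_split; apply: eq_bigr => i _ /=.
by rewrite scalerDl scalerA.
Qed.

(** The three errors add up to at most [3 * h], while [e * a' >= e * a - e * h >= 7 * h]. *)
Lemma ratio_perturbation (R : realFieldType) (e a a' s s' h : R) :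
  0 < e <= 1 -> `|a' - a| <= h -> `|s' - s| <= h -> `|a - s| < h -> e * a = 8 * h ->
  `|s' - a'| <= e * a'.
Proof.
move=> /andP[e0 e1]; rewrite !ler_norml ltr_norml => /andP[h1 h2] /andP[h3 h4] /andP[h5 h6] ea.
have n1 : e * (a - h) <= e * a' by rewrite ler_wpM2l ?(ltW e0)//; lra.
have n2 : e * h <= h by rewrite ler_piMl//; lra.
by move: n1; rewrite mulrBr ea => n1; apply/andP; split; lra.
Qed.

Section ultrapower_finitely_representable.
Context {R : realType}.
Variable Y : completeNormedModType R.
Local Notation Z := (ultrapower Y).

Section combinations.
Variables (n : nat) (b : 'I_n -> Z).
Hypothesis b_free : forall c : 'I_n -> R, \sum_(j < n) c j *: b j = 0 -> forall j, c j = 0.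

Let comb (c : 'I_n -> R) : Z := \sum_(j < n) c j *: b j.
Let coord_comb (c : 'I_n -> R) i : Y := \sum_(j < n) c j *: urep (b j) i.


Lemma coord_comb_bounded c : coord_comb c \in bounded_seq.
Proof. by have [] := ucls_sum (index_enum 'I_n) c (fun j => urep_bounded (b j)). Qed.

Lemma ucls_coord_comb c : ucls (coord_comb c) = comb c.
Proof.
have [_ ->] := ucls_sum (index_enum 'I_n) c (fun j => urep_bounded (b j)).
by apply: eq_bigr => j _; rewrite urepK.
Qed.

(* Otherwise pick a normalized violating coefficient vector at each index i; the limit
   of these vectors along the ultrafilter is normalized and has a null combination. *)
Lemma almost_isometric_coordinate (e : R) : 0 < e < 1 ->
  exists i, forall c, (1 - e) * `|comb c| <= `|coord_comb c i| <= (1 + e) * `|comb c|.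
Proof.
move=> /andP[e0 e1]; apply: contrapT => no.
have /choice[c hc] : forall i, exists c : 'I_n -> R, \sum_(j < n) `|c j| = 1 /\
    e * `|comb c| < `| `|coord_comb c i| - `|comb c| |.
  move=> i; have [c] : exists c, ~ ((1 - e) * `|comb c| <= `|coord_comb c i| <= (1 + e) * `|comb c|).
    by apply/existsNP => h; apply: no; exists i.
  move=> hc; have {}hc : e * `|comb c| < `| `|coord_comb c i| - `|comb c| |.
    rewrite ltNge; apply/negP => h; apply: hc; move: h.
    by rewrite ler_norml => /andP[h1 h2]; apply/andP; split; lra.
  (* The violation is homogeneous in [c] and strict, hence impossible for [c = 0], so [c] can be
     scaled to unit sum of absolute values. *)
  pose N := \sum_(j < n) `|c j|.
  have N0 : 0 < N.
    rewrite lt_def sumr_ge0// andbT; apply/negP => /eqP N0.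
    have c0 j : c j = 0.
      apply/eqP; rewrite -normr_le0 -N0 /N (bigD1 j)//= lerDl; exact: sumr_ge0.
    move: hc; rewrite /comb /coord_comb !big1 => [|j _|j _]; rewrite ?c0 ?scale0r//.
    by rewrite !normr0 mulr0 subrr normr0 ltxx.
  have NV : 0 < N^-1 by rewrite invr_gt0.
  exists (fun j => N^-1 * c j); split.
    under eq_bigr do rewrite normrM (gtr0_norm NV).
    by rewrite -mulr_sumr mulVf// gt_eqF.
  have -> : comb (fun j => N^-1 * c j) = N^-1 *: comb c.
    by rewrite /comb scaler_sumr; apply: eq_bigr => j _; rewrite scalerA.
  have -> : coord_comb (fun j => N^-1 * c j) i = N^-1 *: coord_comb c i.
    by rewrite /coord_comb scaler_sumr; apply: eq_bigr => j _; rewrite scalerA.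
  rewrite !normrZ (gtr0_norm NV) -mulrBr normrM (gtr0_norm NV) mulrCA.
  by rewrite ltr_pM2l.
have cb j i : `|c i j| <= 1.
  have [<- _] := hc i; rewrite (bigD1 j)//= lerDl; exact: sumr_ge0.
pose l j := ulim (fun i => c i j).
have cl j : (fun i => c i j) @ ufilter --> l j by apply: ulim_cvg => i; exact: cb.
have l1 : \sum_(j < n) `|l j| = 1.
  have : (fun i => \sum_(j < n) `|c i j|) @ ufilter --> \sum_(j < n) `|l j|.
    by apply: cvg_big => // [|j _]; [exact: add_continuous|exact: cvg_norm].
  have -> : (fun i => \sum_(j < n) `|c i j|) = fun=> 1.
    by apply/funext => i; case: (hc i).
  by move=> /(cvg_lim (@norm_hausdorff _ _)) <-; rewrite lim_cst.
have l0 : 0 < `|comb l|.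
  rewrite normr_gt0; apply/eqP => /b_free lz.
  move: l1; rewrite big1 => [/eqP|j _]; last by rewrite lz normr0.
  by rewrite eq_sym oner_eq0.
have /choice[B hB] : forall j, exists B : R, 0 <= B /\ forall i, `|urep (b j) i| <= B.
  move=> j; have /bounded_seqP[B hB] := urep_bounded (b j).
  by exists B; split=> //; exact: le_trans (hB 0%N).
(* One error term serves twice: it bounds the effect of replacing [c i] by [l] both in the
   ultrapower and at the coordinate [i]. *)
pose E i := \sum_(j < n) `|c i j - l j| * (B j + `|b j|).
have E0 : E @ ufilter --> 0.
  have -> : 0 = \sum_(j < n) `|l j - l j| * (B j + `|b j|).
    by rewrite big1// => j _; rewrite subrr normr0 mul0r.
  apply: cvg_big => // [|j _]; first exact: add_continuous.
  apply: cvgMl; apply: cvg_norm; apply: cvgB => //; exact: cvg_cst.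
have cE i : `|comb (c i) - comb l| <= E i.
  rewrite /comb -sumrB; apply: (le_trans (ler_norm_sum _ _ _)); apply: ler_sum => j _.
  by rewrite -scalerBl normrZ ler_wpM2l// lerDr; case: (hB j).
have xE i : `|coord_comb (c i) i - coord_comb l i| <= E i.
  rewrite /coord_comb -sumrB; apply: (le_trans (ler_norm_sum _ _ _)); apply: ler_sum => j _.
  rewrite -scalerBl normrZ ler_wpM2l//; case: (hB j) => _ /(_ i) h.
  by apply: (le_trans h); rewrite lerDl.
have xl := ucls_cvg (coord_comb_bounded l).
rewrite ucls_coord_comb in xl.
pose h := e * `|comb l| / 8.
have h0 : 0 < h by rewrite divr_gt0// mulr_gt0.
have /cvgrPdist_lt/(_ _ h0) E1 := E0; have /cvgrPdist_lt/(_ _ h0) x1 := xl.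
have [i [/= Ei xi]] := filter_ex (filterI E1 x1).
have [_ hi] := hc i; have ci := cE i; have xi' := xE i.
move: Ei; rewrite sub0r normrN ger0_norm; last first.
  by apply: sumr_ge0 => j _; rewrite mulr_ge0// addr_ge0//; case: (hB j).
move=> Ei; move: hi; apply/negP; rewrite -leNgt.
have n1 : `| `|comb (c i)| - `|comb l| | <= h.
  by apply: (le_trans (ler_dist_dist _ _)); apply: (le_trans ci); exact: ltW.
have n2 : `| `|coord_comb (c i) i| - `|coord_comb l i| | <= h.
  by apply: (le_trans (ler_dist_dist _ _)); apply: (le_trans xi'); exact: ltW.
apply: ratio_perturbation n1 n2 xi _ => //; first by rewrite e0 ltW.
by rewrite /h [RHS]mulrC divfK// pnatr_eq0.
Qed.

End combinations.

(** A suitable coordinate maps the subspace almost isometrically into [Y], and [Y] is finitely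
    representable in [X]; the two maps are composed. *)
Lemma ultrapower_finitely_representable (X : completeNormedModType R) :
  finitely_representable Y X -> finitely_representable Z X.
Proof.
move=> YX eps /andP[eps0 eps1] M [_ [n0 [b0 ->]]].
have [n [b [-> b_free]]] := independent_generators b0.
(* Two distortions compose to at most [eps], since [(1 + e)^2 <= 1 + 3 * e] and
   [(1 - e)^2 >= 1 - 3 * e]. *)
pose e := eps / 3.
have e01 : 0 < e < 1 by rewrite /e; apply/andP; split; lra.
have [i hi] := almost_isometric_coordinate b_free e01.
pose lin (c : 'I_n -> R) : Y := \sum_(j < n) c j *: urep (b j) i.
have [|S [Slin Siso]] := YX e e01 (range lin).
  by split; [exact: combination_submod|exists n, (fun j => urep (b j) i)].
have /choice[co hco] : forall z : Z, exists c : 'I_n -> R,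
    range (fun c : 'I_n -> R => \sum_(j < n) c j *: b j) z -> \sum_(j < n) c j *: b j = z.
  move=> z; have [[c _ <-]|nz] := pselect (range (fun c : 'I_n -> R => \sum_(j < n) c j *: b j) z).
    by exists c.
  by exists (fun=> 0).
exists (fun z => S (lin (co z))); split=> [a u v Mu Mv|z Mz].
  have -> : lin (co (a *: u + v)) = a *: lin (co u) + lin (co v).
    rewrite /lin scaler_sumr -big_split; apply: eq_bigr => j _ /=.
    (* The coefficients in [co] are merely chosen; independence of [b] makes them unique, hence
       linear on the subspace. *)
    rewrite scalerA -scalerDl; congr (_ *: _); apply/eqP; rewrite -subr_eq0; apply/eqP.
    apply: (b_free (fun j => co (a *: u + v) j - (a * co u j + co v j))).
    under eq_bigr do rewrite scalerBl scalerDl -scalerA.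
    rewrite sumrB big_split -scaler_sumr /= !hco ?subrr//.
    have := @combination_submod R Z n b => -[_ /(_ a u v)]; rewrite !inE; exact.
  by apply: Slin; [exists (co u)|exists (co v)].
have := hi (co z); rewrite hco// => /andP[h1 h2].
have /andP[h3 h4] := Siso (lin (co z)) ltac:(by exists (co z)).
move: h1 h2; rewrite -/(lin _); set q := `|lin _| in h3 h4 * => h1 h2.
have [/andP[e0 e1] z0] := (e01, normr_ge0 z).
have eE : eps = 3 * e by rewrite /e [RHS]mulrC divfK// pnatr_eq0.
have ez : 0 <= e * `|z| by rewrite mulr_ge0// ltW.
have eez : e * (e * `|z|) <= e * `|z| by rewrite ler_piMl// ltW.
have eez0 : 0 <= e * (e * `|z|) by rewrite mulr_ge0// ltW.
rewrite eE; apply/andP; split.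
  apply: le_trans h3; apply: (@le_trans _ _ ((1 - e) * ((1 - e) * `|z|))).
    by lra.
  by rewrite ler_wpM2l// subr_ge0 ltW.
apply: (le_trans h4); apply: (@le_trans _ _ ((1 + e) * ((1 + e) * `|z|))).
  by rewrite ler_wpM2l// addr_ge0// ltW.
by lra.
Qed.

End ultrapower_finitely_representable.

(** * Ultrapowers of bounded convex sets *)

Section ultraset.
Context {R : realType} {Y : completeNormedModType R}.
Implicit Types (C : set Y) (x y : nat -> Y).

Lemma uclsB x y : x \in bounded_seq -> y \in bounded_seq ->
  ucls (fun n => x n - y n) = ucls x - ucls y.
Proof.
move=> bx by_; rewrite -[X in _ = _ + X]scaleN1r addrC -ucls_linear//.
by congr ucls; apply/funext => n; rewrite scaleN1r addrC.
Qed.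

Lemma bounded_seqB x y : x \in bounded_seq -> y \in bounded_seq ->
  (fun n => x n - y n) \in bounded_seq.
Proof.
move=> /bounded_seqP[M hM] /bounded_seqP[N hN]; apply/bounded_seqP.
by exists (M + N) => n; apply: (le_trans (ler_normB _ _)); apply: lerD.
Qed.

Lemma ucls_dist_le x y (c : R) : x \in bounded_seq -> y \in bounded_seq ->
  ufilter [set n | `|x n - y n| <= c] -> `|ucls x - ucls y| <= c.
Proof. by move=> bx by_ h; rewrite -uclsB//; apply: ucls_le => //; exact: bounded_seqB. Qed.

Lemma ucls_dist_lt x y (c : R) : x \in bounded_seq -> y \in bounded_seq ->
  `|ucls x - ucls y| < c -> ufilter [set n | `|x n - y n| < c].
Proof. by move=> bx by_; rewrite -uclsB// => /ucls_lt; apply; exact: bounded_seqB. Qed.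

Definition ultraset C : set (ultrapower Y) :=
  [set z | exists2 x, (forall n, C (x n)) & z = ucls x].

Lemma bounded_set_seq C x : bounded_set C -> (forall n, C (x n)) -> x \in bounded_seq.
Proof.
by move=> /bounded_setP[M hM] Cx; apply/bounded_seqP; exists M => n; exact: hM.
Qed.

Lemma ultraset_bounded C : bounded_set C -> bounded_set (ultraset C).
Proof.
move=> bC; have [M hM] := (bounded_setP C).1 bC.
apply/bounded_setP; exists M => _ [x Cx ->]; apply: ucls_le.
  exact: bounded_set_seq bC Cx.
by apply: filterE => n; exact: hM.
Qed.

Lemma ultraset_convex C : bounded_set C -> convex_set C -> convex_set (ultraset C).
Proof.
move=> bC /convex_setP vC; apply/convex_setP => _ _ t [x Cx ->] [y Cy ->] t01.
have bx := bounded_set_seq bC Cx; have by_ := bounded_set_seq bC Cy.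
exists (fun n => t *: x n + (1 - t) *: y n); first by move=> n; exact: vC.
rewrite [RHS](_ : _ = ucls (fun n => t *: (x n - y n) + y n)); last first.
  congr ucls; apply/funext => n.
  by rewrite scalerBl scale1r scalerBr -!addrA; congr (_ + _); rewrite addrC.
rewrite (ucls_linear t (bounded_seqB bx by_) by_) uclsB//.
by rewrite scalerBl scale1r scalerBr -!addrA; congr (_ + _); rewrite addrC.
Qed.

(** Choose [x n] in [C] within [1/(n+1)] of being a nearest point to the [n]-th coordinate of [z].
    Any point of the ultraset near [z] then forces [x] to be as near, up to an error vanishing along
    the ultrafilter, so [x] represents [z]. *)
Lemma ultraset_closed C : C !=set0 -> bounded_set C -> closed (ultraset C).
Proof.
move=> [c0 Cc0] bC; apply/closed_setP => z hz.
have /choice[x hx] : forall n : nat, exists a, C a /\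
    forall c, C c -> `|urep z n - a| <= `|urep z n - c| + n.+1%:R^-1.
  move=> n; pose S := [set `|urep z n - c| | c in C].
  have hS : has_inf S.
    by split; [exists `|urep z n - c0|; exists c0|exists 0 => _ [c _ <-]].
  have n0 : (0 : R) < n.+1%:R^-1 by rewrite invr_gt0.
  have [_ [a Ca <-] ha] := inf_adherent n0 hS.
  exists a; split=> // c Cc; apply: (le_trans (ltW ha)); rewrite lerD2r.
  by apply: ge_inf; [case: hS|exists c].
have Cx n : C (x n) by case: (hx n).
exists x => //; apply: dist_eq => e e0.
have bx := bounded_set_seq bC Cx; have bz := urep_bounded z.
rewrite -[z in z - _]urepK; apply: ucls_dist_le => //.
have [_ [c Cc ->]] := hz _ (divr_gt0 e0 (ltr0n _ 2)).
have bc := bounded_set_seq bC Cc.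
rewrite -[z in z - _]urepK => /(ucls_dist_lt bz bc) zc.
have [k ke] := invS_lt (divr_gt0 e0 (ltr0n _ 2)).
apply: filterS2 zc (ufilter_ge k) => n /= zcn kn.
have [_ /(_ _ (Cc n)) h] := hx n; apply: (le_trans h).
have : n.+1%:R^-1 <= k.+1%:R^-1 :> R by rewrite lef_pV2 ?posrE// ler_nat.
set u := n.+1%:R^-1; set v := k.+1%:R^-1 in ke *; lra.
Qed.

End ultraset.

(** * Fixed points of asymptotically nonexpansive maps *)

Section asymptotically_nonexpansive.
Context {R : realType} {Y : completeNormedModType R}.
Variables (C : set Y) (T : Y -> Y).
Hypotheses (C0 : C !=set0) (bC : bounded_set C) (cC : closed C) (vC : convex_set C).
Hypothesis TC : set_fun C C T.
Hypothesis T_asymp : forall h : R, 0 < h -> exists N, forall k, (N <= k)%N ->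
  forall x y, C x -> C y -> `|iter k T x - iter k T y| <= `|x - y| + h.
Hypothesis fppZ : FPP_nonexpansive (ultrapower Y).

Definition eventually_almost_fixed (e : R) (y : Y) :=
  exists N, forall k, (N <= k)%N -> `|iter k T y - y| <= e.

Lemma iter_set k x : C x -> C (iter k T x).
Proof. by move=> Cx; elim: k => //= k; exact: TC. Qed.

(** As [f n >= n], the exponent passes the threshold for any given excess at almost every index, so
    no excess survives in the limit. *)
Lemma ucls_iter_nonexpansive (f : nat -> nat) (x y : nat -> Y) :
  (forall n, n <= f n)%N -> (forall n, C (x n)) -> (forall n, C (y n)) ->
  `|ucls (fun n => iter (f n) T (x n)) - ucls (fun n => iter (f n) T (y n))| <=
  `|ucls x - ucls y|.
Proof.
move=> nf Cx Cy.
have bx := bounded_set_seq bC Cx; have by_ := bounded_set_seq bC Cy.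
apply/ler_addgt0Pr => e e0.
have [N hN] := T_asymp (divr_gt0 e0 (ltr0n _ 2)).
have : `|ucls x - ucls y| < `|ucls x - ucls y| + e / 2 by rewrite ltrDl divr_gt0.
move=> /(ucls_dist_lt bx by_) xy.
apply: ucls_dist_le; [| |apply: filterS2 xy (ufilter_ge N) => n /= xyn Nn].
- by apply: (bounded_set_seq bC) => n; exact: iter_set.
- by apply: (bounded_set_seq bC) => n; exact: iter_set.
- by apply: (le_trans (hN _ (leq_trans Nn (nf n)) _ _ (Cx n) (Cy n))); lra.
Qed.

(** The accuracy [d] may be far smaller than [e], yet the displacement is controlled by [e] alone;
    this is what makes iteration converge. *)
Lemma almost_fixed_improvement (e d : R) y : C y -> 0 < e -> 0 < d ->
  eventually_almost_fixed e y ->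
  exists z, [/\ C z, eventually_almost_fixed d z & `|z - y| <= 3 * e].
Proof.
move=> Cy e0 d0 [N hN].
have /choice[rep hrep] : forall z : ultrapower Y, exists x : nat -> Y,
    ultraset C z -> (forall n, C (x n)) /\ ucls x = z.
  move=> z; have [[x Cx ->]|nz] := pselect (ultraset C z); first by exists x.
  by exists (fun=> y).
(* The exponent [n + f n] is at least [n] for every [f], so the family is indexed by all
   functions. *)
pose tau (f : nat -> nat) (z : ultrapower Y) : ultrapower Y :=
  ucls (fun n => iter (n + f n) T (rep z n)).
pose orb (f : nat -> nat) : ultrapower Y := ucls (fun n => iter (f n) T y).
(* This is a limsup over functions [f] ordered pointwise; the slack [e' > e] makes [D] closed. *)
pose D := [set z | ultraset C z /\ forall e', e < e' -> exists g : nat -> nat,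
  forall f, (forall n, g n <= f n)%N -> `|z - orb f| <= e'].
have DC z : D z -> ultraset C z by case.
have Ctau f z : ultraset C z -> forall n, C (iter (n + f n) T (rep z n)).
  by move=> /hrep[Cx _] n; exact: iter_set.
have tauC f z : ultraset C z -> ultraset C (tau f z).
  by move=> Cz; exists (fun n => iter (n + f n) T (rep z n)) => //; exact: Ctau.
have tauN f x z : ultraset C x -> ultraset C z -> `|tau f x - tau f z| <= `|x - z|.
  move=> /hrep[Cx xE] /hrep[Cz zE].
  rewrite -[X in _ <= `|X - _|]xE -[X in _ <= `|_ - X|]zE.
  by apply: ucls_iter_nonexpansive => // n; exact: leq_addr.
have tauE f x : (forall n, C (x n)) -> tau f (ucls x) = ucls (fun n => iter (n + f n) T (x n)).
  move=> Cx; have /hrep[Cr rx] : ultraset C (ucls x) by exists x.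
  apply/eqP; rewrite -subr_eq0 -normr_le0.
  apply: le_trans (ucls_iter_nonexpansive _ Cr Cx) _ => [n|]; first exact: leq_addr.
  by rewrite rx subrr normr0.
have Dy : D (ucls (fun=> y)).
  split; first by exists (fun=> y).
  move=> e' ee'; exists (fun=> N) => f Nf; rewrite distrC.
  apply: ucls_dist_le; [| |apply: (@filterE _ ufilter) => n /=].
  - by apply: (bounded_set_seq bC) => n; exact: iter_set.
  - exact: (bounded_set_seq bC).
  - by apply: le_trans (ltW ee'); exact: hN.
have [||||||z Dz hz] := @approximate_common_fixed _ _ fppZ _ tau D (d / 2).
- by exists (ucls (fun=> y)).
- have [M hM] := (bounded_setP _).1 (ultraset_bounded bC).
  by apply/bounded_setP; exists M => z /DC; exact: hM.
- apply/closed_setP => z zD; split.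
    have /closed_setP := ultraset_closed C0 bC; apply=> e' /zD[x /DC Cx zx].
    by exists x.
  move=> e' ee'; have h0 : 0 < (e' - e) / 2 by rewrite divr_gt0// subr_gt0.
  have [x [_ Dx] zx] := zD _ h0.
  have [|g hg] := Dx (e + (e' - e) / 2); first by lra.
  exists g => f /hg h; apply: (le_trans (ler_distD x _ _)); lra.
- apply/convex_setP => x z t [Cx Dx] [Cz Dz] t01; split.
    by apply: (convex_setP _).1 t01 => //; exact: ultraset_convex.
  move=> e' ee'; have [g hg] := Dx e' ee'; have [h hh] := Dz e' ee'.
  exists (fun n => maxn (g n) (h n)) => f gf.
  have : `|x - orb f| <= e' by apply: hg => n; exact: leq_trans (leq_maxl _ _) (gf n).
  have : `|z - orb f| <= e' by apply: hh => n; exact: leq_trans (leq_maxr _ _) (gf n).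
  move=> zf xf; have -> : t *: x + (1 - t) *: z - orb f =
      t *: (x - orb f) + (1 - t) *: (z - orb f).
    by rewrite !scalerBr [RHS]addrACA -opprD -scalerDl (addrC t) subrK scale1r.
  move/andP: t01 => [t0 t1]; apply: (le_trans (ler_normD _ _)); rewrite !normrZ.
  have -> : e' = t * e' + (1 - t) * e' by ring.
  by rewrite ger0_norm// ger0_norm ?subr_ge0// lerD// ler_wpM2l ?subr_ge0.
- split=> [f z [Cz Dz]|f x z /DC Cx /DC Cz|f g z /DC Cz]; [|exact: tauN|].
    split; first exact: tauC.
    move=> e' ee'; have [g hg] := Dz e' ee'.
    exists (fun n => n + f n + g n)%N => h gh.
    have [Cr rz] := hrep _ Cz.
    (* Splitting [n + f n] steps off the exponent [h n] leaves one that still dominates [g]. *)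
    pose h' n := (h n - (n + f n))%N.
    have -> : orb h = ucls (fun n => iter (n + f n) T (iter (h' n) T y)).
      congr ucls; apply/funext => n; rewrite -iterD subnKC//.
      exact: leq_trans (leq_addr _ _) (gh n).
    apply: le_trans (ucls_iter_nonexpansive _ Cr _) _ => [n|n|]; first exact: leq_addr.
      exact: iter_set.
    rewrite rz; apply: hg => n; rewrite /h' leq_subRL//.
    exact: leq_trans (leq_addr _ _) (gh n).
  rewrite (tauE f _ (Ctau g z Cz)) (tauE g _ (Ctau f z Cz)).
  by congr ucls; apply/funext => n; rewrite -!iterD addnC.
- by rewrite divr_gt0.
have [Cz Dz'] := Dz; have [Cx xz] := hrep _ Cz; set x := rep z in Cx xz.
have bx := bounded_set_seq bC Cx.
have byc : (fun=> y) \in bounded_seq := bounded_set_seq bC (fun=> Cy).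
(* Together with the distance [e] from [orb f] to [y] this gives [5 / 2 * e], strictly below
   [3 * e], as needed to descend to coordinates. *)
have [|g hg] := Dz' (3 / 2 * e); first by lra.
pose f n := maxn (g n) N.
have zf : `|z - orb f| <= 3 / 2 * e by apply: hg => n; exact: leq_maxl.
have fy : `|orb f - ucls (fun=> y)| <= e.
  apply: ucls_dist_le => //; first by apply: (bounded_set_seq bC) => n; exact: iter_set.
  by apply: (@filterE _ ufilter) => n; apply: hN; exact: leq_maxr.
have : `|z - ucls (fun=> y)| < 3 * e.
  by apply: (le_lt_trans (ler_distD (orb f) _ _)); lra.
rewrite -xz => /(ucls_dist_lt bx byc) xy.
apply: contrapT => no.
(* If no coordinate close to [y] is eventually [d]-fixed, each has a bad exponent at least [n].
   Collected in [k], they contradict that [tau k] moves [z] by at most [d / 2]. *)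
have /choice[k hk] : forall n, exists k, (`|x n - y| < 3 * e -> d < `|iter (n + k) T (x n) - x n|).
  move=> n; have [xyn|_] := boolP (`|x n - y| < 3 * e); last by exists 0%N.
  apply: contrapT => nk; apply: no; exists (x n); split=> //; last exact: ltW.
  exists n => m nm; rewrite leNgt; apply/negP => dm; apply: nk.
  by exists (m - n)%N => _; rewrite subnKC.
have : `|tau k z - z| < d by apply: (le_lt_trans (hz k)); lra.
rewrite -[z in _ - z]xz => /ucls_dist_lt => /(_ (bounded_set_seq bC (Ctau k _ Cz)) bx) kx.
have [n [/= xyn]] := filter_ex (filterI xy kx).
by rewrite ltNge => /negP; apply; exact/ltW/hk.
Qed.

Hypothesis T_cont : {within C, continuous T}.

Lemma asymptotically_nonexpansive_fixed_point : exists2 x, C x & T x = x.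
Proof.
have [y0 Cy0] := C0; have [M hM] := (bounded_setP C).1 bC.
have M0 : 0 <= M by exact: le_trans (hM _ Cy0).
(* Any point of [C] is almost fixed up to [2 * M], so the iteration can start at [y0]; the [+ 1]
   keeps [B] positive. *)
pose B := 2 * M + 1; have B0 : 0 < B by rewrite /B; lra.
have h2 n : 0 < (2^-1 : R) ^+ n by rewrite exprn_gt0// invr_gt0.
have Bn n : 0 < B * 2^-1 ^+ n by rewrite mulr_gt0.
pose good n y := C y /\ eventually_almost_fixed (B * 2^-1 ^+ n) y.
have /choice[h hh] : forall ny : nat * Y, exists z, good ny.1 ny.2 ->
    good ny.1.+1 z /\ `|z - ny.2| <= 3 * (B * 2^-1 ^+ ny.1).
  move=> [n y] /=; have [[Cy fy]|ngy] := pselect (good n y); last by exists y.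
  have [z [Cz fz zy]] := almost_fixed_improvement Cy (Bn n) (Bn n.+1) fy.
  by exists z.
pose u := fix u n := if n is m.+1 then h (m, u m) else y0.
have gu n : good n (u n).
  elim: n => [|n IH] /=; last by case: (hh (n, u n) IH).
  split=> //; exists 0%N => k _; rewrite expr0 mulr1.
  apply: (le_trans (ler_normB _ _)).
  by have := hM _ (iter_set k Cy0); have := hM _ Cy0; rewrite /B; lra.
have uk n k : `|u (n + k)%N - u n| <= 6 * (B * 2^-1 ^+ n) - 6 * (B * 2^-1 ^+ (n + k)).
  elim: k => [|k IH]; first by rewrite addn0 !subrr normr0.
  rewrite addnS; apply: (le_trans (ler_distD (u (n + k)%N) _ _)).
  have [_ /= h3] := hh ((n + k)%N, u (n + k)%N) (gu _).
  by rewrite exprS; lra.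
have uk' n k : `|u (n + k)%N - u n| <= 6 * (B * 2^-1 ^+ n).
  by apply: (le_trans (uk n k)); have := Bn (n + k)%N; lra.
have small e : 0 < e -> exists n, B * 2^-1 ^+ n < e.
  by move=> /(geom_lt B)[n hn]; exists n; rewrite exprVn.
have [y uy] : exists y : Y, u @ \oo --> y.
  apply: cauchy_seq_cvg => e e0.
  have [n hn] := small _ (divr_gt0 e0 (ltr0n _ 6)).
  by exists n => m nm; rewrite -(subnKC nm); apply: (le_trans (uk' _ _)); lra.
have Cy : C y.
  apply: (closed_setP C).1 cC _ _ => e e0; have [n hn] := cvg_dist_lt uy e0.
  by exists (u n); [case: (gu n)|exact: hn].
(* For large [k], [iter k T y] is close to [iter k T (u j)], hence to [u j], hence to [y]. *)
have yfix e : 0 < e -> exists N, forall k, (N <= k)%N -> `|iter k T y - y| <= e.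
  move=> e0; have [n hn] := small _ (divr_gt0 e0 (ltr0n _ 4)).
  have [m hm] := cvg_dist_lt uy (divr_gt0 e0 (ltr0n _ 8)).
  pose j := maxn n m.
  have [Cu [N hN]] := gu j; have [N' hN'] := T_asymp (divr_gt0 e0 (ltr0n _ 8)).
  exists (maxn N N') => k; rewrite geq_max => /andP[Nk N'k].
  have jy := hm j (leq_maxr _ _).
  have jn : B * 2^-1 ^+ j <= B * 2^-1 ^+ n.
    by rewrite ler_pM2l// ler_wiXn2l ?leq_maxl//; lra.
  have k1 := hN _ Nk; have k2 := hN' _ N'k _ _ Cy Cu.
  have := ler_distD (iter k T (u j)) (iter k T y) y.
  have := ler_distD (u j) (iter k T (u j)) y.
  by rewrite (distrC (u j) y); lra.
exists y => //; apply: dist_eq => e e0.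
have /subspace_continuousP/(_ y Cy)/cvgrPdist_lt := T_cont.
move=> /(_ _ (divr_gt0 e0 (ltr0n _ 2))); rewrite /within /= => /nbhs_ballP[d /= d0 hd].
have [N hN] := yfix _ (divr_gt0 d0 (ltr0n _ 2)).
have [N' hN'] := yfix _ (divr_gt0 e0 (ltr0n _ 2)).
pose k := maxn N N'.
have k1 := hN k (leq_maxl _ _); have k2 := hN' k.+1 (leqW (leq_maxr _ _)).
(* By continuity at [y] the iterates [k.+1] approach [T y], while they also approach [y]. *)
have : `|T y - T (iter k T y)| < e / 2.
  apply: hd; last exact: iter_set.
  by rewrite -ball_normE /= distrC; apply: (le_lt_trans k1); lra.
move: k2 => /=; have := ler_distD (T (iter k T y)) (T y) y; lra.
Qed.

End asymptotically_nonexpansive.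

(** * Comparison of the two classes of maps, and the equivalence *)

Lemma intermediate_eventually (R : realType) (Y : completeNormedModType R)
    (C : set Y) (T : Y -> Y) :
  intermediate_asymptotically_nonexpansive_on C T ->
  forall h : R, 0 < h -> exists N, forall k, (N <= k)%N ->
  forall x y, C x -> C y -> `|iter k T x - iter k T y| <= `|x - y| + h.
Proof.
move=> [_ sup0] h h0.
have : (limn_esup (fun n => ereal_sup [set (`|iter n T x - iter n T y| - `|x - y|)%:E
    | x in C & y in C]) < h%:E)%E by apply: le_lt_trans sup0 _; rewrite lte_fin.
(* The upper limit is an infimum of suprema over eventual sets of indices, so one such supremum is
   already below [h]. *)
move=> /ereal_inf_lt[_ [A [N _ NA] <-]] supA; exists N => k Nk x y Cx Cy.
rewrite -lerBlDl -lee_fin; apply: le_trans (ltW supA).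
apply: (@le_trans _ _ (ereal_sup [set (`|iter k T x - iter k T y| - `|x - y|)%:E
    | x in C & y in C])).
  by apply: ereal_sup_ubound; exists x => //; exists y.
by apply: ereal_sup_ubound; exists k => //; exact: NA.
Qed.

Lemma nonexpansive_intermediate (R : realType) (Y : completeNormedModType R)
    (C : set Y) (T : Y -> Y) :
  set_fun C C T -> nonexpansive_on C T ->
  intermediate_asymptotically_nonexpansive_on C T.
Proof.
move=> TC TN; split.
  apply/subspace_continuousP => x Cx; apply/cvgrPdist_lt => e e0.
  rewrite /within /=; apply/nbhs_ballP; exists e => // y; rewrite -ball_normE /= => xy Cy.
  exact: le_lt_trans (TN _ _ Cx Cy) xy.
apply: (@le_trans _ _ (ereal_sup ((fun n => ereal_sup
    [set (`|iter n T x - iter n T y| - `|x - y|)%:E | x in C & y in C]) @` setT))).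
  by apply: ereal_inf_lbound; exists setT => //; exact: filterT.
apply: ge_ereal_sup => _ [n _ <-]; apply: ge_ereal_sup => _ [x Cx [y Cy <-]].
rewrite lee_fin subr_le0; elim: n => //= n; apply: le_trans.
have iC m z : C z -> C (iter m T z) by move=> Cz; elim: m => //= m; exact: TC.
by apply: TN; exact: iC.
Qed.

Theorem theorem2p4 (R : realType) (X : completeNormedModType R) :
  super FPP_nonexpansive X <->
  super FPP_intermediate_asymptotically_nonexpansive X.
Proof.
split=> fppX Y YX C C0 bC cC vC T TC TK.
  (* The super property is applied to the ultrapower of [Y], where the induced maps are
     nonexpansive. *)
  apply: asymptotically_nonexpansive_fixed_point => //.
  - exact: intermediate_eventually TK.
  - exact/fppX/ultrapower_finitely_representable.
  - by case: TK.
by apply: (fppX Y YX C) => //; exact: nonexpansive_intermediate.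
Qed.
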